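(* Lorentz covariance and the de Broglie wave-particle duality hypothesis (both as defined in the context) are compatible with a wave function that is not a strict scalar under a Lorentz boost, i.e. that transforms as $\Psi(\mathbf r,t)=g(\mathbf r',t')\Psi'(\mathbf r',t')$ with non-constant $g$. Requiring, for a particle of mass $m$, that the non-relativistic approximation of $g$ (the exponent of $g$ expanded in powers of $v/c$, keeping only the dominant terms) tends to the transformation law of the Schrödinger wave function under a Galilean boost, $$\exp\left[\frac{i}{\hbar}\left(\frac{mv^2}{2}t'+m\,\mathbf v\cdot\mathbf r'\right)\right],$$ uniquely determines $g$ and its associated wave equation: for a Lorentz boost with velocity $\mathbf v$, $v=|\mathbf v|$, $\gamma=1/\sqrt{1-v^2/c^2}$, $$g(\mathbf r',t')=\exp\left\{\frac{i}{\hbar}\left[(\gamma-1)mc^2t'+\gamma m\,\mathbf v\cdot\mathbf r'\right]\right\},$$ and the wave equation is the Lorentz covariant Schrödinger equation $$\partial_\mu\partial^\mu\Psi-i\frac{2mc}{\hbar}\partial_0\Psi+\frac{2mV}{\hbar^2}\Psi=0,$$ which can also be written as $$-\frac{\hbar^2}{2mc^2}\frac{\partial^2\Psi}{\partial t^2}+i\hbar\frac{\partial\Psi}{\partial t}=-\frac{\hbar^2}{2m}\nabla^2\Psi+V\Psi .$$ Here $V$ is a relativistic scalar under proper Lorentz transformations whose non-relativistic limit tends to the Newtonian potential energy.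
   Context: Notation: $x=(x^0,x^1,x^2,x^3)=(ct,\mathbf r)$, $\partial_\mu=\partial/\partial x^\mu$, metric $\mathrm{diag}(1,-1,-1,-1)$, so $\partial_\mu\partial^\mu=\frac{1}{c^2}\partial_t^2-\nabla^2$; repeated indices are summed; $c$ is the speed of light in vacuum and $\hbar$ the reduced Planck constant. Wave equation: the most general homogeneous linear partial differential equation in $x,y,z,t$ of order at most two, $a^{\mu\nu}\partial_\mu\partial_\nu\Psi+b^\mu\partial_\mu\Psi+f\,\Psi=0$, with constant coefficients $a^{\mu\nu},b^\mu$ multiplying the derivatives and an arbitrary function $f(x)$. It must provide solutions that propagate waves along spacetime; an equation without time derivatives is not a wave equation. Equations are identified up to an overall constant factor, and $V$ is $f$ renamed up to a constant factor. Frames: a rotation relates inertial frames $S$ and $S'$ by $\mathbf r'=M\mathbf r$, $t'=t$, $M\in SO(3)$. A Lorentz boost with speed $v$ along the $x^1$-axis is $x^0=\gamma(x^{0'}+\beta x^{1'})$, $x^1=\gamma(x^{1'}+\beta x^{0'})$, $x^2=x^{2'}$, $x^3=x^{3'}$ with $\beta=v/c$, $\gamma=1/\sqrt{1-\beta^2}$, and analogously for other directions of $\mathbf v$. The function $f$ is a strict scalar: $f(x)=f'(x')$. Under rotations $\Psi(x)=\Psi'(x')$; under a boost $\Psi(x)=g(x')\Psi'(x')$ with $g$ an arbitrary nonvanishing function, to be determined. Lorentz covariance: if $S'$ is connected to $S$ by a spatial rotation or a Lorentz boost and the wave equation holds in $S$, then in $S'$ it reads, up to an overall nonzero multiplicative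 factor, $a^{\mu\nu}\partial_{\mu'}\partial_{\nu'}\Psi'+b^\mu\partial_{\mu'}\Psi'+f'\Psi'=0$ with the same constants $a^{\mu\nu},b^\mu$. De Broglie wave-particle duality hypothesis: a massive particle has an associated wave function governed by the wave equation, and its energy and momentum are connected to the angular frequency $\omega$ and wave vector $\mathbf k$ of that wave by $E=\hbar\omega$, $\mathbf p=\hbar\mathbf k$. In the present setting $\hbar\omega$ is understood as the kinetic energy of a free particle. The duality is to be valid in any inertial frame, so the wave function of a moving free particle cannot be zero or infinite in magnitude.
   Formalization: The conditions determine g only up to a factor constant in spacetime (e.g. exp(i v^4/c^4) may multiply g), so g is proved unique up to such a factor, and exactly equal to the formula under the added assumption that factors of successive boosts multiply consistently. *)

(* Defs.v *)
From HB Require Import structures.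
From mathcomp Require Import all_boot all_order all_algebra.
From mathcomp Require Import all_classical all_reals all_analysis.
From mathcomp.real_closed Require Import complex.

Set Implicit Arguments.
Unset Strict Implicit.
Unset Printing Implicit Defensive.

Import Order.TTheory GRing.Theory Num.Theory.
Import numFieldNormedType.Exports.

Local Open Scope classical_set_scope.
Local Open Scope ring_scope.
Local Open Scope complex_scope.

(* Complex-valued functions.  R[i] carries no R-normed-module structure in the
   libraries, so derivatives, smoothness and limits are taken on the real and
   imaginary parts. *)
Section Complex.
Context {R : realType}.

Definition cexp (z : R[i]) : R[i] :=
  (expR (complex.Re z) * cos (complex.Im z))
  +i* (expR (complex.Re z) * sin (complex.Im z)).

Definition cderive {E : normedModType R} (v : E) (F : E -> R[i]) (x : E) : R[i] :=
  ('D_v (fun y => complex.Re (F y)) x)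
  +i* ('D_v (fun y => complex.Im (F y)) x).

Definition ccvg {T : Type} (H : set_system T) (F : T -> R[i]) (l : R[i]) : Prop :=
  (fun t => Normc.normc (F t - l)) @ H --> (0 : R).

End Complex.

Section Spacetime.
Context {R : realType}.

Definition vec3 := 'cV[R]_3.
(* An event is the column (x^0, x^1, x^2, x^3) with x^0 = c t. *)
Definition spacetime := 'cV[R]_(1 + 3).

Definition event (c t : R) (r : vec3) : spacetime := col_mx (c * t)%:M r.
Definition time_of (c : R) (x : spacetime) : R := x 0 0 / c.
Definition space_of (x : spacetime) : vec3 := dsubmx x.

Definition dot (u v : vec3) : R := \sum_i u i 0 * v i 0.
Definition speed (v : vec3) : R := Num.sqrt (dot v v).
Definition subluminal (c : R) (v : vec3) : Prop := speed v < c.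
Definition gamma (c : R) (v : vec3) : R :=
  (Num.sqrt (1 - (speed v / c) ^+ 2))^-1.

Definition minkowski : 'M[R]_(1 + 3) := block_mx 1%:M 0 0 (- 1%:M).

(* Frame changes are given by the matrix L of x = L x', from the coordinates x'
   of S' to the coordinates x of S. *)

Definition is_rotation (M : 'M[R]_3) : Prop := M *m M^T = 1%:M /\ \det M = 1.

(* r' = M r and t' = t, that is r = M^T r' *)
Definition rot_mx (M : 'M[R]_3) : 'M[R]_(1 + 3) := block_mx 1%:M 0 0 M^T.

(* x^0 = gamma (x^0' + beta n.r'),
   r = r' + (gamma - 1) (n.r') n + gamma beta x^0' n, with v = c beta n; for
   v = 0 the coefficient (gamma - 1) / |v|^2 is 0 / 0 = 0 and this is the
   identity. *)
Definition boost_mx (c : R) (v : vec3) : 'M[R]_(1 + 3) :=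
  block_mx (gamma c v)%:M ((gamma c v / c) *: v^T)
           ((gamma c v / c) *: v)
           (1%:M + ((gamma c v - 1) / speed v ^+ 2) *: (v *m v^T)).

Definition is_proper_lorentz (L : 'M[R]_(1 + 3)) : Prop :=
  L^T *m minkowski *m L = minkowski /\ \det L = 1.

Definition partial (mu : 'I_(1 + 3)) (F : spacetime -> R[i]) :
  spacetime -> R[i] := cderive (delta_mx mu 0 : spacetime) F.

Definition C2_real (h : spacetime -> R) : Prop :=
  [/\ forall x, differentiable h x,
      forall mu x, differentiable ('D_(delta_mx mu 0 : spacetime) h) x &
      forall mu nu, continuous
        ('D_(delta_mx nu 0 : spacetime) ('D_(delta_mx mu 0 : spacetime) h))].

Definition C2 (F : spacetime -> R[i]) : Prop :=
  C2_real (fun x => complex.Re (F x)) /\ C2_real (fun x => complex.Im (F x)).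

End Spacetime.

Arguments vec3 : clear implicits.
Arguments spacetime : clear implicits.

Section WaveEquation.
Context {R : realType}.

(* a^{mu nu} d_mu d_nu Psi + b^mu d_mu Psi + f Psi = 0 *)
Record wave_eq := WaveEq {
  coef2 : 'M[R[i]]_(1 + 3);
  coef1 : 'cV[R[i]]_(1 + 3);
  coef0 : spacetime R -> R[i] }.

Definition wave_op (W : wave_eq) (Psi : spacetime R -> R[i]) (x : spacetime R) :
  R[i] :=
  \sum_mu \sum_nu coef2 W mu nu * partial mu (partial nu Psi) x
  + \sum_mu coef1 W mu 0 * partial mu Psi x + coef0 W x * Psi x.

(* A time derivative occurs; coef2 is not assumed symmetric, but only its
   symmetric part acts on C^2 functions. *)
Definition has_time_derivative (W : wave_eq) : Prop :=
  coef1 W 0 0 != 0 \/ exists mu, coef2 W 0 mu + coef2 W mu 0 != 0.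

Definition same_equation (W W' : wave_eq) : Prop :=
  exists2 k : R[i], k != 0 & forall Psi, C2 Psi ->
    forall x, wave_op W Psi x = k * wave_op W' Psi x.

(* When x = L x' and Psi(x) = s(x') Psi'(x'), substituting turns the equation W
   for Psi into the equation W' for Psi', up to a nonvanishing factor. *)
Definition reads_as (W W' : wave_eq) (L : 'M[R]_(1 + 3))
    (s : spacetime R -> R[i]) : Prop :=
  exists2 lam : spacetime R -> R[i], (forall x', lam x' != 0) &
    forall Psi Psi' : spacetime R -> R[i], C2 Psi -> C2 Psi' ->
      (forall x', Psi (L *m x') = s x' * Psi' x') ->
      forall x', wave_op W Psi (L *m x') = lam x' * wave_op W' Psi' x'.

(* same constants, and f'(x') = f(x) *)
Definition in_frame (L : 'M[R]_(1 + 3)) (W : wave_eq) : wave_eq :=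
  WaveEq (coef2 W) (coef1 W) (fun x' => coef0 W (L *m x')).

(* g v is the factor of the boost with velocity v: Psi(x) = g v x' Psi'(x') *)
Definition is_boost_factor (c : R) (g : vec3 R -> spacetime R -> R[i]) : Prop :=
  forall v, subluminal c v -> C2 (g v) /\ forall x', g v x' != 0.

Definition lorentz_covariant (c : R) (W : wave_eq)
    (g : vec3 R -> spacetime R -> R[i]) : Prop :=
  (forall M, is_rotation M ->
     reads_as W (in_frame (rot_mx M) W) (rot_mx M) (fun=> 1)) /\
  (forall v, subluminal c v ->
     reads_as W (in_frame (boost_mx c v) W) (boost_mx c v) (g v)).

(* Two boosts S <- S' <- S'' whose composite is again a boost transform the
   wave function in the same way as that boost. *)
Definition composes (c : R) (g : vec3 R -> spacetime R -> R[i]) : Prop :=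
  forall v1 v2 w, subluminal c v1 -> subluminal c v2 -> subluminal c w ->
    boost_mx c v1 *m boost_mx c v2 = boost_mx c w ->
    forall x, g w x = g v1 (boost_mx c v2 *m x) * g v2 x.

End WaveEquation.

Arguments wave_eq : clear implicits.

Section DeBroglie.
Context {R : realType}.

Definition plane_wave (c omega : R) (k : vec3 R) (x : spacetime R) : R[i] :=
  cexp ('i%C * (dot k (space_of x) - omega * time_of c x)%:C).

(* the wave of a free particle of energy E and momentum p, E = hbar omega and
   p = hbar k *)
Definition matter_wave (hbar c E : R) (p : vec3 R) : spacetime R -> R[i] :=
  plane_wave c (E / hbar) (hbar^-1 *: p).

Definition free (W : wave_eq R) : wave_eq R :=
  WaveEq (coef2 W) (coef1 W) (fun=> 0).

(* The worldline r' = t' u in S' is the worldline r = t w in S. *)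
Definition velocity_map (c : R) (L : 'M[R]_(1 + 3)) (u w : vec3 R) : Prop :=
  exists s : R, L *m event c 1 u = s *: event c 1 w.

(* The wave of the free particle in S' is turned by the transformation law of
   wave functions into the wave of the same particle in S, up to a constant
   amplitude A; the latter has the finite nonzero magnitude |A| everywhere. *)
Definition duality_in_frames (hbar c : R) (L : 'M[R]_(1 + 3))
    (s : spacetime R -> R[i]) (T : vec3 R -> R) (p : vec3 R -> vec3 R) :
    Prop :=
  forall u w, subluminal c u -> subluminal c w -> velocity_map c L u w ->
    exists2 A : R[i], A != 0 & forall x',
      s x' * matter_wave hbar c (T u) (p u) x'
      = A * matter_wave hbar c (T w) (p w) (L *m x').

(* T u and p u are the kinetic energy and the momentum of the free particle in
   a frame where its velocity is u. *)
Definition de_broglie (hbar c : R) (W : wave_eq R)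
    (g : vec3 R -> spacetime R -> R[i])
    (T : vec3 R -> R) (p : vec3 R -> vec3 R) : Prop :=
  [/\ T 0 = 0 /\ p 0 = 0,
      forall u, subluminal c u -> forall x,
        wave_op (free W) (matter_wave hbar c (T u) (p u)) x = 0,
      forall M, is_rotation M ->
        duality_in_frames hbar c (rot_mx M) (fun=> 1) T p &
      forall v, subluminal c v ->
        duality_in_frames hbar c (boost_mx c v) (g v) T p].

Definition kinetic_energy (c m : R) (u : vec3 R) : R :=
  (gamma c u - 1) * m * c ^+ 2.
Definition momentum (c m : R) (u : vec3 R) : vec3 R := (gamma c u * m) *: u.

(* exponent of the factor of the Schroedinger wave function under a Galilean
   boost *)
Definition galilean_exponent (hbar c m : R) (v : vec3 R) (x' : spacetime R) :
    R[i] :=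
  'i%C * (hbar^-1 * (m * speed v ^+ 2 / 2 * time_of c x'
                   + m * dot v (space_of x')))%:C.

(* The expansion in powers of v/c of an exponent of g, at a given event, has the
   Galilean exponent as its terms of the orders 1 and 2: these are the dominant
   ones in r' and in t' respectively. *)
Definition galilean_limit (hbar c m : R) (g : vec3 R -> spacetime R -> R[i]) :
    Prop :=
  exists2 phi : vec3 R -> spacetime R -> R[i],
    forall v, subluminal c v -> forall x', g v x' = cexp (phi v x') &
    forall x',
      Normc.normc (phi v x' - galilean_exponent hbar c m v x')
        / (speed v / c) ^+ 2 @[v --> (0 : vec3 R)^'] --> (0 : R).

End DeBroglie.

Section CovariantSchroedinger.
Context {R : realType}.

Definition lcse_factor (hbar c m : R) (v : vec3 R) (x' : spacetime R) : R[i] :=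
  cexp ('i%C * (hbar^-1 * ((gamma c v - 1) * m * c ^+ 2 * time_of c x'
                         + gamma c v * m * dot v (space_of x')))%:C).

(* d_mu d^mu Psi - i (2 m c / hbar) d_0 Psi + (2 m V / hbar^2) Psi = 0 *)
Definition lcse (hbar c m : R) (V : spacetime R -> R[i]) : wave_eq R :=
  WaveEq (map_mx (fun a : R => a%:C) minkowski)
         ((- 'i%C * (2 * m * c / hbar)%:C) *: delta_mx 0 0)
         (fun x => (2 * m / hbar ^+ 2)%:C * V x).

(* Wave functions of t and r. *)
Definition in_tr (c : R) (Psi : spacetime R -> R[i]) (t : R) (r : vec3 R) :
  R[i] := Psi (event c t r).

Definition d_t (psi : R -> vec3 R -> R[i]) (t : R) (r : vec3 R) : R[i] :=
  cderive (1 : R^o) (fun s : R^o => psi s r) t.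

Definition laplacian (psi : R -> vec3 R -> R[i]) (t : R) (r : vec3 R) : R[i] :=
  \sum_i cderive (delta_mx i 0 : vec3 R)
           (cderive (delta_mx i 0 : vec3 R) (psi t)) r.

(* - hbar^2 / (2 m c^2) d_t^2 psi + i hbar d_t psi *)
Definition lcse_time_part (hbar c m : R) (psi : R -> vec3 R -> R[i])
    (t : R) (r : vec3 R) : R[i] :=
  - (hbar ^+ 2 / (2 * m * c ^+ 2))%:C * d_t (d_t psi) t r
  + 'i%C * hbar%:C * d_t psi t r.

(* - hbar^2 / (2 m) nabla^2 psi + V psi *)
Definition hamiltonian (hbar m : R) (V psi : R -> vec3 R -> R[i])
    (t : R) (r : vec3 R) : R[i] :=
  - (hbar ^+ 2 / (2 * m))%:C * laplacian psi t r + V t r * psi t r.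

End CovariantSchroedinger.

(* Main.v *)
(* Let kappa = m c / hbar.  Writing Psi = exp (i kappa x^0) Phi turns the equation
   into d_mu d^mu Phi + kappa^2 Phi + (2 m V / hbar^2) Phi = 0, which is covariant
   for a scalar Phi.  Hence Psi (L x) = exp (i kappa ((L x)^0 - x^0)) Psi' x for
   every Lorentz matrix L, and this phase is the boost factor.

   Conversely, the de Broglie hypothesis for a particle at rest makes every boost
   factor a constant times a plane wave of covector xi, so that covariance can be
   tested on plane waves, where it reads P ((z + xi) L^-1) = k P z for the symbol P
   of the equation.  The second differences in z show that the second-order part
   is a multiple of the Minkowski form, and the first differences express xi by
   the first-order part; one real parameter remains, fixed by the Galilean limit.
   When boosts compose, the constant A v satisfies A v = A v_n ^ (2 ^ n) for the
   velocity v_n obtained by halving the rapidity n times, and the Galilean limit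
   gives A v_n = exp (O (4 ^ - n)), so that A v = 1. *)

Require Import Defs.
From mathcomp Require Import all_boot all_order all_algebra.
From mathcomp Require Import all_classical all_reals all_analysis.
From mathcomp.real_closed Require Import complex.
From mathcomp Require Import fingroup perm.
From mathcomp Require Import ring lra.

Import Order.TTheory GRing.Theory Num.Theory.
Import numFieldNormedType.Exports.

Local Open Scope classical_set_scope.
Local Open Scope ring_scope.
Local Open Scope complex_scope.

(* These names of Defs also denote library lemmas or definitions. *)
Local Notation coef0 := Defs.coef0.
Local Notation coef1 := Defs.coef1.
Local Notation free := Defs.free.
Local Notation minkowski := Defs.minkowski.

(** * Differential calculus of complex-valued functions *)

Section ComplexCalculus.
Set Implicit Arguments.
Unset Strict Implicit.
Context {R : realType}.
Implicit Types (z w A : R[i]) (a b : R).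

(** Covariance leaves two unknowns free: the function f and the overall factor. Symbols are
    therefore compared at the origin, which every frame change fixes: f enters both sides as the
    same constant f(0), and only the quadratic and linear parts in z are used. The factor k is
    forced to be 1 because some coefficient is nonzero: under rotations this comes from the required
    time derivative, under boosts from the second-order coefficient, whose vanishing a boost
    excludes. The parameter that remains is real because wave covectors are real.

    The Galilean limit is harder to use than it looks. It speaks of some logarithm of g, chosen
    event by event and velocity by velocity, so exponents may be neither subtracted nor compared
    directly: they are known only modulo 2 pi i. Only exponentials are compared. Taking two events
    for the same velocity cancels the unknown constant g v 0, and the sine of the remaining phase,
    bounded above by the limit and below by the mean value theorem, yields the parameter. At the
    event 0 the Galilean exponent vanishes, which is why the limit also controls the constant
    itself. *)

Lemma complex_ext z w :
  complex.Re z = complex.Re w -> complex.Im z = complex.Im w -> z = w.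
Proof. by case: z w => [? ?] [? ?] /= -> ->. Qed.

Lemma ReD z w : complex.Re (z + w) = complex.Re z + complex.Re w.
Proof. by case: z w => [? ?] [? ?]. Qed.

Lemma ImD z w : complex.Im (z + w) = complex.Im z + complex.Im w.
Proof. by case: z w => [? ?] [? ?]. Qed.

Lemma ReM z w : complex.Re (z * w)
  = complex.Re z * complex.Re w - complex.Im z * complex.Im w.
Proof. by case: z w => [? ?] [? ?]. Qed.

Lemma ImM z w : complex.Im (z * w)
  = complex.Re z * complex.Im w + complex.Im z * complex.Re w.
Proof. by case: z w => [? ?] [? ?]. Qed.

Lemma ReN z : complex.Re (- z) = - complex.Re z. Proof. by case: z. Qed.

Lemma ImN z : complex.Im (- z) = - complex.Im z. Proof. by case: z. Qed.

Definition complexP := (ReD, ImD, ReM, ImM, ReN, ImN).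

Lemma mulii : 'i%C * 'i%C = -1 :> R[i].
Proof. by rewrite -expr2 sqr_i. Qed.

Lemma imaginary_neq0 : 'i%C != 0 :> R[i].
Proof. by apply/eqP => -[] /eqP; rewrite oner_eq0. Qed.

Lemma cexpD z w : cexp (z + w) = cexp z * cexp w.
Proof.
case: z w => [a b] [a' b']; apply: complex_ext;
  rewrite /= expRD ?cosD ?sinD; ring.
Qed.

Lemma cexp0 : cexp (0 : R[i]) = 1.
Proof. by apply: complex_ext; rewrite /= expR0 ?cos0 ?sin0 ?mulr1 ?mulr0. Qed.

Lemma cexpN_mul z : cexp z * cexp (- z) = 1.
Proof. by rewrite -cexpD subrr cexp0. Qed.

Lemma cexp_neq0 z : cexp z != 0.
Proof.
apply/eqP => z0; have := cexpN_mul z; rewrite z0 mul0r => /esym/eqP.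
by rewrite oner_eq0.
Qed.

Lemma cexp_imaginary a : cexp ('i%C * a%:C) = cos a +i* sin a.
Proof.
rewrite /cexp !complexP /= !mul0r !mul1r subr0 add0r.
by rewrite expR0 !mul1r.
Qed.

Lemma normc_ge_Re z : `|complex.Re z| <= Normc.normc z.
Proof. by rewrite -lecR (_ : (Normc.normc z)%:C = `|z|) // normc_ge_Re. Qed.

Lemma normc_ge_Im z : `|complex.Im z| <= Normc.normc z.
Proof.
case: z => a b /=; rewrite -sqrtr_sqr ler_wsqrtr //.
by rewrite lerDr sqr_ge0.
Qed.

Lemma normcB_triangle z w : Normc.normc (z - w) <= Normc.normc z + Normc.normc w.
Proof. by rewrite -(normcN w); apply: le_normcD. Qed.

Lemma normc_ge0 z : 0 <= Normc.normc z.
Proof. by case: z => a b; apply: sqrtr_ge0. Qed.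

Lemma normc_real a : Normc.normc (a%:C) = `|a|.
Proof. by rewrite /= expr0n addr0 sqrtr_sqr. Qed.

Lemma normc_imaginary a : Normc.normc ('i%C * a%:C) = `|a|.
Proof. by rewrite Normc.normcM normc_real /= expr0n expr1n add0r sqrtr1 mul1r. Qed.

Section Derivative.
Context {E : normedModType R}.
Implicit Types (F G : E -> R[i]) (x v : E).

Definition is_cderive x v F z :=
  is_derive x v (fun y => complex.Re (F y)) (complex.Re z) /\
  is_derive x v (fun y => complex.Im (F y)) (complex.Im z).

Definition cdiff F x :=
  differentiable (fun y => complex.Re (F y)) x /\
  differentiable (fun y => complex.Im (F y)) x.

Lemma is_cderive_val x v F z : is_cderive x v F z -> cderive v F x = z.
Proof. by move=> [dr di]; apply: complex_ext => /=; apply: derive_val. Qed.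

Lemma is_cderive_eq x v F z w : is_cderive x v F z -> z = w -> is_cderive x v F w.
Proof. by move=> ? <-. Qed.

Lemma cdiff_is_cderive x v F : cdiff F x -> is_cderive x v F (cderive v F x).
Proof. by case=> dr di; split; apply: derivableP; apply: diff_derivable. Qed.

Lemma is_cderive_cst x v A : is_cderive x v (fun=> A) 0.
Proof. by split; apply: is_derive_cst. Qed.

Lemma is_cderiveD x v F G z w : is_cderive x v F z -> is_cderive x v G w ->
  is_cderive x v (fun y => F y + G y) (z + w).
Proof.
move=> [? ?] [? ?]; split; rewrite complexP.
- rewrite (_ : (fun _ => _) =
    (fun y => complex.Re (F y)) + (fun y => complex.Re (G y))).
    exact: is_deriveD.
  by apply/funext => y; rewrite complexP.
- rewrite (_ : (fun _ => _) =
    (fun y => complex.Im (F y)) + (fun y => complex.Im (G y))).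
    exact: is_deriveD.
  by apply/funext => y; rewrite complexP.
Qed.

Lemma is_cderiveM x v F G z w : is_cderive x v F z -> is_cderive x v G w ->
  is_cderive x v (fun y => F y * G y) (z * G x + F x * w).
Proof.
move=> [? ?] [? ?]; split.
- rewrite (_ : (fun _ => _) =
    (fun y => complex.Re (F y)) * (fun y => complex.Re (G y))
    - (fun y => complex.Im (F y)) * (fun y => complex.Im (G y))).
    by apply: is_derive_eq; rewrite !complexP /GRing.scale /=; ring.
  by apply/funext => y; rewrite complexP.
- rewrite (_ : (fun _ => _) =
    (fun y => complex.Re (F y)) * (fun y => complex.Im (G y))
    + (fun y => complex.Im (F y)) * (fun y => complex.Re (G y))).
    by apply: is_derive_eq; rewrite !complexP /GRing.scale /=; ring.
  by apply/funext => y; rewrite complexP.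
Qed.

Lemma is_cderiveZ x v F z A : is_cderive x v F z ->
  is_cderive x v (fun y => A * F y) (A * z).
Proof.
move=> /(is_cderiveM (is_cderive_cst x v A)); rewrite mul0r add0r; exact.
Qed.

Lemma is_cderive_sum x v (I : Type) (s : seq I) (F : I -> E -> R[i]) (z_ : I -> R[i]) :
  (forall i, is_cderive x v (F i) (z_ i)) ->
  is_cderive x v (fun y => \sum_(i <- s) F i y) (\sum_(i <- s) z_ i).
Proof.
move=> dF; elim: s => [|i s IHs].
  rewrite (_ : (fun _ => _) = fun=> 0) ?big_nil; first exact: is_cderive_cst.
  by apply/funext => y; rewrite big_nil.
rewrite (_ : (fun _ => _) = fun y => F i y + \sum_(j <- s) F j y).
  by rewrite big_cons; apply: is_cderiveD.
by apply/funext => y; rewrite big_cons.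
Qed.

Lemma cdiff_cst x A : cdiff (fun=> A) x.
Proof. by split; apply: differentiable_cst. Qed.

Lemma cdiffM x F G : cdiff F x -> cdiff G x -> cdiff (fun y => F y * G y) x.
Proof.
move=> [? ?] [? ?]; split.
- rewrite (_ : (fun _ => _) =
    (fun y => complex.Re (F y)) * (fun y => complex.Re (G y))
    - (fun y => complex.Im (F y)) * (fun y => complex.Im (G y))).
    by apply: differentiableB; apply: differentiableM.
  by apply/funext => y; rewrite complexP.
- rewrite (_ : (fun _ => _) =
    (fun y => complex.Re (F y)) * (fun y => complex.Im (G y))
    + (fun y => complex.Im (F y)) * (fun y => complex.Re (G y))).
    by apply: differentiableD; apply: differentiableM.
  by apply/funext => y; rewrite complexP.
Qed.

Lemma cdiffD x F G : cdiff F x -> cdiff G x -> cdiff (fun y => F y + G y) x.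
Proof.
move=> [? ?] [? ?]; split.
- rewrite (_ : (fun _ => _) =
    (fun y => complex.Re (F y)) + (fun y => complex.Re (G y))).
    exact: differentiableD.
  by apply/funext => y; rewrite complexP.
- rewrite (_ : (fun _ => _) =
    (fun y => complex.Im (F y)) + (fun y => complex.Im (G y))).
    exact: differentiableD.
  by apply/funext => y; rewrite complexP.
Qed.

Lemma cdiff_sum x (I : Type) (s : seq I) (F : I -> E -> R[i]) :
  (forall i, cdiff (F i) x) -> cdiff (fun y => \sum_(i <- s) F i y) x.
Proof.
move=> dF; elim: s => [|i s IHs].
  rewrite (_ : (fun _ => _) = fun=> 0); first exact: cdiff_cst.
  by apply/funext => y; rewrite big_nil.
rewrite (_ : (fun _ => _) = fun y => F i y + \sum_(j <- s) F j y).
  exact: cdiffD.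
by apply/funext => y; rewrite big_cons.
Qed.

End Derivative.

Lemma cderive_sum_basis n (F : 'cV[R]_n.+1 -> R[i]) (x w : 'cV[R]_n.+1) :
  cdiff F x ->
  cderive w F x = \sum_mu (w mu 0)%:C * cderive (delta_mx mu 0) F x.
Proof.
have linD (h : 'cV[R]_n.+1 -> R) : differentiable h x ->
    'D_w h x = \sum_mu w mu 0 * 'D_(delta_mx mu 0) h x.
  move=> dh; rewrite deriveE // {1}(matrix_sum_delta w) linear_sum.
  by apply: eq_bigr => mu _; rewrite big_ord1 linearZ deriveE.
have ReS (f : 'I_n.+1 -> R[i]) :
    complex.Re (\sum_i f i) = \sum_i complex.Re (f i).
  exact: (big_morph _ ReD).
have ImS (f : 'I_n.+1 -> R[i]) :
    complex.Im (\sum_i f i) = \sum_i complex.Im (f i).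
  exact: (big_morph _ ImD).
case=> dr di; apply: complex_ext; rewrite /= ?ReS ?ImS linD //;
  by apply: eq_bigr => mu _; rewrite complexP /= mul0r ?subr0 ?addr0.
Qed.

(** By linearity of [L], both sides have the same difference quotient as a function of the step. *)
Lemma is_cderive_mulmx m n (L : 'M[R]_(m.+1, n.+1)) (F : 'cV[R]_m.+1 -> R[i])
    (x v : 'cV[R]_n.+1) : cdiff F (L *m x) ->
  is_cderive x v (fun y => F (L *m y)) (cderive (L *m v) F (L *m x)).
Proof.
have line (h : 'cV[R]_m.+1 -> R) : differentiable h (L *m x) ->
    is_derive x v (fun y => h (L *m y)) ('D_(L *m v) h (L *m x)).
  move=> /(diff_derivable (v := L *m v)); rewrite /derivable => dh.
  have eqL : (fun t : R => t^-1 *: (h (L *m (t *: v + x)) - h (L *m x)))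
      = (fun t : R => t^-1 *: (h (t *: (L *m v) + L *m x) - h (L *m x))).
    by apply/funext => t; rewrite mulmxDr -scalemxAr.
  by apply: DeriveDef; rewrite /derivable /derive /comp /= eqL.
by case=> dr di; split; apply: line.
Qed.

End ComplexCalculus.

(** * Symmetry of mixed second derivatives *)

Section Schwarz.
Set Implicit Arguments.
Unset Strict Implicit.
Context {R : realType} {E : normedModType R}.
Implicit Types (h : E -> R) (x y u v : E).

Lemma is_derive_line h y u t : derivable h (t *: u + y) u ->
  is_derive t 1 (fun s : R => h (s *: u + y)) ('D_u h (t *: u + y)).
Proof.
rewrite /derivable => dh.
have eqh : (fun s : R => s^-1 *: (h ((s *: (1 : R) + t) *: u + y) - h (t *: u + y)))
    = (fun s : R => s^-1 *: (h (s *: u + (t *: u + y)) - h (t *: u + y))).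
  by apply/funext => s; rewrite [s *: 1]mulr1 scalerDl addrA.
by apply: DeriveDef; rewrite /derivable /derive /comp /= eqh.
Qed.

Lemma ler_dist_halves (a b w e : R) :
  `|a - w| < e / 2 -> `|b - w| < e / 2 -> `|a - b| <= e.
Proof.
by rewrite !ltr_norml ler_norml => /andP[? ?] /andP[? ?]; apply/andP; split; lra.
Qed.

(** The mean value theorem applied twice: to the increment of [h] in the direction [v], as a
    function of the displacement along [u], then to ['D_u h] along [v]. *)
Lemma second_difference h x u v (s : R) : 0 < s ->
  (forall y, derivable h y u) -> (forall y, derivable ('D_u h) y v) ->
  exists y, `|y - x| <= s * (`|u| + `|v|) /\
    h (s *: u + (s *: v + x)) - h (s *: u + x) - h (s *: v + x) + h x
    = s ^+ 2 * 'D_v ('D_u h) y.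
Proof.
move=> s0 hu huv.
pose f (t : R) : R := h (t *: u + (s *: v + x)) - h (t *: u + x).
pose df (t : R) : R := 'D_u h (t *: u + (s *: v + x)) - 'D_u h (t *: u + x).
have f' (t : R) : is_derive t 1 f (df t).
  by apply: is_deriveB; apply: is_derive_line.
have cont (k dk : R -> R) : (forall t : R, is_derive t 1 k (dk t)) ->
    {within `[0, s], continuous k}.
  move=> k'; apply: derivable_within_continuous => t _.
  by case: (k' t).
have [t1 /andP[t10 t1s] eq1] := MVT s0 (fun t _ => f' t) (cont _ _ f').
pose k (t : R) : R := 'D_u h (t *: v + (t1 *: u + x)).
pose dk (t : R) : R := 'D_v ('D_u h) (t *: v + (t1 *: u + x)).
have k' (t : R) : is_derive t 1 k (dk t) by apply: is_derive_line.
have [t2 /andP[t20 t2s] eq2] := MVT s0 (fun t _ => k' t) (cont _ _ k').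
rewrite !bnd_simp in t10 t1s t20 t2s.
exists (t2 *: v + (t1 *: u + x)); split.
  rewrite addrA addrK (le_trans (ler_normD _ _)) // !normrZ.
  rewrite (gtr0_norm t10) (gtr0_norm t20) addrC mulrDr.
  by rewrite lerD // ler_wpM2r // ltW.
move: eq1; rewrite /f !scale0r !add0r subr0 => eq1.
rewrite (_ : _ + h x = h (s *: u + (s *: v + x)) - h (s *: u + x)
  - (h (s *: v + x) - h x)); last ring.
rewrite eq1 /df; move: eq2; rewrite /k /dk scale0r add0r subr0.
rewrite [t1 *: u + (s *: v + x)]addrCA => ->; ring.
Qed.

(** The second difference is symmetric in [u] and [v]. Evaluated in both orders, it shows that the
    two mixed derivatives agree at points [y1] and [y2] arbitrarily close to [x]; continuity at [x]
    does the rest. *)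
Lemma derive_comm h x u v :
  (forall y, derivable h y u) -> (forall y, derivable h y v) ->
  (forall y, derivable ('D_u h) y v) -> (forall y, derivable ('D_v h) y u) ->
  {for x, continuous ('D_v ('D_u h))} -> {for x, continuous ('D_u ('D_v h))} ->
  'D_v ('D_u h) x = 'D_u ('D_v h) x.
Proof.
move=> hu hv huv hvu c1 c2.
apply/eqP; rewrite -subr_eq0 -normr_le0; apply/ler_addgt0Pr => e e0.
have e20 : 0 < e / 2 by lra.
have /cvgrPdist_lt/(_ _ e20)/nbhs_ballP[d1 /= d10 b1] := c1.
have /cvgrPdist_lt/(_ _ e20)/nbhs_ballP[d2 /= d20 b2] := c2.
pose d := Num.min d1 d2; have d0 : 0 < d by rewrite /d lt_min d10.
pose M := `|u| + `|v|; have M0 : 0 <= M by rewrite addr_ge0.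
(* The [+ 1] covers the case where [u] and [v] both vanish; [s * M < d] puts both intermediate
   points in the balls of continuity. *)
pose s := d / (M + 1).
have s0 : 0 < s by rewrite divr_gt0 // ltr_wpDl.
have sd : s * M < d.
  by rewrite /s mulrAC ltr_pdivrMr ?ltr_wpDl // ltr_pM2l // ltrDl.
have [y1 [ny1 eq1]] := second_difference x s0 hu huv.
have [y2 [ny2 eq2]] := second_difference x s0 hv hvu.
have yb1 : ball x d1 y1.
  rewrite -ball_normE /= distrC (le_lt_trans ny1) // (lt_le_trans sd) //.
  by rewrite /d ge_min lexx.
have yb2 : ball x d2 y2.
  rewrite -ball_normE /= distrC (le_lt_trans ny2) // addrC (lt_le_trans sd) //.
  by rewrite /d ge_min lexx orbT.
have eqy : 'D_v ('D_u h) y1 = 'D_u ('D_v h) y2.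
  have s20 : s ^+ 2 != 0 by rewrite expf_neq0 // gt_eqF.
  apply: (mulfI s20); apply: etrans (esym eq1) (etrans _ eq2).
  rewrite [s *: v + (s *: u + x)]addrCA.
  by congr (_ + _); rewrite addrAC.
rewrite add0r; apply: (@ler_dist_halves _ _ ('D_v ('D_u h) y1)).
- exact: b1.
- by rewrite eqy; apply: b2.
Qed.

End Schwarz.

(** * The wave operator on plane waves and under linear substitutions *)

Section WaveOperator.
Set Implicit Arguments.
Unset Strict Implicit.
Context {R : realType}.
Local Notation C := (R[i]).
Local Notation rowST := ('rV[R]_(1 + 3)).
Implicit Types (z : rowST) (x : spacetime R) (F : spacetime R -> C) (A : C).

Lemma cdiff_continuous F : (forall x, cdiff F x) ->
  continuous (fun x => complex.Re (F x)) /\ continuous (fun x => complex.Im (F x)).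
Proof.
by move=> dF; split=> x; apply: differentiable_continuous; case: (dF x).
Qed.

Lemma C2_cdiff F x : C2 F -> cdiff F x.
Proof. by case=> -[dr _ _] [di _ _]. Qed.

Lemma C2_cdiff_partial F mu x : C2 F -> cdiff (partial mu F) x.
Proof. by case=> -[_ dr _] [_ di _]; split; [apply: dr|apply: di]. Qed.

Lemma derive_comm_C2 (h : spacetime R -> R) mu nu x : C2_real h ->
  'D_(delta_mx nu 0 : spacetime R) ('D_(delta_mx mu 0 : spacetime R) h) x
  = 'D_(delta_mx mu 0 : spacetime R) ('D_(delta_mx nu 0 : spacetime R) h) x.
Proof.
case=> d1 d2 c2; apply: derive_comm.
- by move=> y; apply/diff_derivable/d1.
- by move=> y; apply/diff_derivable/d1.
- by move=> y; apply/diff_derivable/d2.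
- by move=> y; apply/diff_derivable/d2.
- exact: c2.
- exact: c2.
Qed.

Lemma partial_comm F mu nu x : C2 F ->
  partial mu (partial nu F) x = partial nu (partial mu F) x.
Proof.
case=> dr di; apply: complex_ext.
- exact: derive_comm_C2 dr.
- exact: derive_comm_C2 di.
Qed.

Lemma cdiff_C2 F : (forall x, cdiff F x) ->
  (forall mu x, cdiff (partial mu F) x) ->
  (forall mu nu x, cdiff (partial nu (partial mu F)) x) -> C2 F.
Proof.
move=> d0 d1 d2; split; split.
- by move=> x; exact: (d0 x).1.
- by move=> mu x; exact: (d1 mu x).1.
- by move=> mu nu; exact: (cdiff_continuous (d2 mu nu)).1.
- by move=> x; exact: (d0 x).2.
- by move=> mu x; exact: (d1 mu x).2.
- by move=> mu nu; exact: (cdiff_continuous (d2 mu nu)).2.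
Qed.

(* The plane wave of wave covector z. *)
Definition pw z x : C := cexp ('i%C * ((z *m x) 0 0)%:C).

Lemma pw0 x : pw 0 x = 1.
Proof. by rewrite /pw mul0mx mxE mulr0 cexp0. Qed.

Lemma pw_at0 z : pw z 0 = 1.
Proof. by rewrite /pw mulmx0 mxE mulr0 cexp0. Qed.

Lemma pwD z z' x : pw (z + z') x = pw z x * pw z' x.
Proof. by rewrite /pw mulmxDl mxE rmorphD mulrDr cexpD. Qed.

Lemma pw_mulmx z (L : 'M[R]_(1 + 3)) x : pw z (L *m x) = pw (z *m L) x.
Proof. by rewrite /pw mulmxA. Qed.

Lemma pw_neq0 z x : pw z x != 0.
Proof. exact: cexp_neq0. Qed.

(** Restricting to a line reduces the derivatives of plane waves to those of the one-variable sine
    and cosine. *)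
Lemma is_derive_from_line (h : spacetime R -> R) x v (d : R) :
  is_derive (0 : R) 1 (fun t : R => h (t *: v + x)) d -> is_derive x v h d.
Proof.
have eqh : (fun t : R => t^-1 *: (h ((t *: (1 : R) + 0) *: v + x)
      - h (0 *: v + x)))
    = (fun t : R => t^-1 *: (h (t *: v + x) - h x)).
  by apply/funext => t; rewrite addr0 scale0r add0r [t *: 1]mulr1.
case; rewrite /derivable /derive /comp /= eqh => dh vh.
exact: DeriveDef.
Qed.

Lemma is_cderive_pw z x v :
  is_cderive x v (pw z) ('i%C * ((z *m v) 0 0)%:C * pw z x).
Proof.
have phase (t : R) : (z *m (t *: v + x)) 0 0 = t * (z *m v) 0 0 + (z *m x) 0 0.
  by rewrite mulmxDr -scalemxAr !mxE.
split; apply: is_derive_from_line.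
- rewrite (_ : (fun _ => _) = fun t : R =>
    cos (t * (z *m v) 0 0 + (z *m x) 0 0)).
    apply: is_derive_eq; rewrite /pw cexp_imaginary !complexP /= /GRing.scale /=.
    by rewrite mul0r add0r; ring.
  by apply/funext => t; rewrite /pw cexp_imaginary phase.
- rewrite (_ : (fun _ => _) = fun t : R =>
    sin (t * (z *m v) 0 0 + (z *m x) 0 0)).
    apply: is_derive_eq; rewrite /pw cexp_imaginary !complexP /= /GRing.scale /=.
    by rewrite mul0r add0r; ring.
  by apply/funext => t; rewrite /pw cexp_imaginary phase.
Qed.

Lemma cdiff_pw z x : cdiff (pw z) x.
Proof.
have dl : differentiable (fun y : spacetime R => (z *m y) 0 0) x.
  rewrite (_ : (fun _ => _) = \sum_mu (z 0 mu *: fun y : spacetime R => y mu 0)).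
    apply: differentiable_sum => mu.
    by apply: differentiableZ; apply: differentiable_coord.
  by apply/funext => y; rewrite mxE fct_sumE.
have comp (k : R -> R) : (forall t : R, derivable k t 1) ->
    differentiable (fun y : spacetime R => k ((z *m y) 0 0)) x.
  move=> dk; apply: (differentiable_comp (g := k) dl).
  by apply/derivable1_diffP.
split.
- rewrite (_ : (fun _ => _) = fun y : spacetime R => cos ((z *m y) 0 0)).
    by apply: comp => t; apply: derivable_cos.
  by apply/funext => y; rewrite /pw cexp_imaginary.
- rewrite (_ : (fun _ => _) = fun y : spacetime R => sin ((z *m y) 0 0)).
    by apply: comp => t; apply: derivable_sin.
  by apply/funext => y; rewrite /pw cexp_imaginary.
Qed.

Lemma partial_pw A z mu :
  partial mu (fun x => A * pw z x) = fun x => ('i%C * (z 0 mu)%:C * A) * pw z x.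
Proof.
apply/funext => x; apply: is_cderive_val.
apply: is_cderive_eq (is_cderiveZ A (is_cderive_pw _ _ _)) _.
rewrite -colE mxE; ring.
Qed.

Lemma cdiff_amplitude_pw A z x : cdiff (fun y => A * pw z y) x.
Proof. by apply: cdiffM; [apply: cdiff_cst|apply: cdiff_pw]. Qed.

Lemma C2_pw A z : C2 (fun x => A * pw z x).
Proof.
apply: cdiff_C2 => *; rewrite ?partial_pw; exact: cdiff_amplitude_pw.
Qed.

(** The full symbol at [x], lower-order terms included: on [pw z], [partial mu] is multiplication by
    i z_mu. *)
Definition symbol (W : wave_eq R) z x : C :=
  \sum_mu \sum_nu coef2 W mu nu * (('i%C * (z 0 mu)%:C) * ('i%C * (z 0 nu)%:C))
  + \sum_mu coef1 W mu 0 * ('i%C * (z 0 mu)%:C) + coef0 W x.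

Lemma wave_op_pw W A z x :
  wave_op W (fun y => A * pw z y) x = symbol W z x * (A * pw z x).
Proof.
rewrite /wave_op /symbol !mulrDl !mulr_suml; congr (_ + _ + _).
  apply: eq_bigr => mu _; rewrite mulr_suml; apply: eq_bigr => nu _.
  by rewrite !partial_pw; ring.
by apply: eq_bigr => mu _; rewrite partial_pw; ring.
Qed.

Definition gradient F x : 'cV[C]_(1 + 3) := \col_mu partial mu F x.

Definition hessian F x : 'M[C]_(1 + 3) :=
  \matrix_(mu, nu) partial mu (partial nu F) x.

Lemma wave_op_mx W F x :
  wave_op W F x = \tr ((coef2 W)^T *m hessian F x)
    + ((coef1 W)^T *m gradient F x) 0 0 + coef0 W x * F x.
Proof.
rewrite /wave_op; congr (_ + _ + _); last first.
  by rewrite mxE; apply: eq_bigr => mu _; rewrite !mxE.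
rewrite /mxtrace; under [RHS]eq_bigr do rewrite mxE.
rewrite exchange_big; apply: eq_bigr => mu _; apply: eq_bigr => nu _.
by rewrite !mxE.
Qed.

Definition toC m n (L : 'M[R]_(m, n)) : 'M[C]_(m, n) :=
  map_mx (real_complex R) L.

Lemma toCE m n (L : 'M[R]_(m, n)) i j : toC L i j = (L i j)%:C.
Proof. by rewrite mxE. Qed.

Lemma toC_mul m n p (L : 'M[R]_(m, n)) (L' : 'M[R]_(n, p)) :
  toC (L *m L') = toC L *m toC L'.
Proof. exact: map_mxM. Qed.

Lemma toC_tr m n (L : 'M[R]_(m, n)) : toC L^T = (toC L)^T.
Proof. by rewrite /toC map_trmx. Qed.

Lemma toC1 n : toC (1%:M : 'M[R]_n) = 1%:M.
Proof. exact: map_mx1. Qed.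

Lemma toCB m n (L L' : 'M[R]_(m, n)) : toC (L - L') = toC L - toC L'.
Proof. exact: map_mxB. Qed.

Lemma toCD m n (L L' : 'M[R]_(m, n)) : toC (L + L') = toC L + toC L'.
Proof. exact: map_mxD. Qed.

Lemma toCZ m n (a : R) (L : 'M[R]_(m, n)) : toC (a *: L) = a%:C *: toC L.
Proof. exact: map_mxZ. Qed.

Lemma toC_delta m n i j : toC (delta_mx i j : 'M[R]_(m, n)) = delta_mx i j.
Proof. exact: map_delta_mx. Qed.

Section Transform.
Variables (eta : rowST) (L : 'M[R]_(1 + 3)).

Let e : 'cV[C]_(1 + 3) := 'i%C *: toC eta^T.

Let eE mu : e mu 0 = 'i%C * (eta 0 mu)%:C.
Proof. by rewrite mxE toCE mxE. Qed.

(** [partial mu] conjugated by the plane wave of covector [eta] and pulled back along [L]. As the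
    plane wave stays in front, second derivatives come from applying it twice. *)
Definition twisted_partial mu F x : C :=
  e mu 0 * F x + \sum_nu (L nu mu)%:C * partial nu F x.

Lemma is_cderive_pw_mulmx F x mu : cdiff F (L *m x) ->
  is_cderive x (delta_mx mu 0) (fun y => pw eta y * F (L *m y))
    (pw eta x * twisted_partial mu F (L *m x)).
Proof.
move=> dF; apply: is_cderive_eq.
  by apply: is_cderiveM (is_cderive_pw _ _ _) (is_cderive_mulmx _ dF).
rewrite cderive_sum_basis // /twisted_partial eE -colE mxE mulrDr.
congr (_ + _); first ring.
congr (_ * _); apply: eq_bigr => nu _.
by rewrite -colE mxE.
Qed.

Lemma is_cderive_twisted_partial F mu x v : C2 F ->
  is_cderive x v (twisted_partial mu F)
    (e mu 0 * cderive v F x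
     + \sum_nu (L nu mu)%:C * cderive v (partial nu F) x).
Proof.
move=> F2; apply: is_cderiveD.
  by apply: is_cderiveZ; apply: cdiff_is_cderive; apply: C2_cdiff.
apply: is_cderive_sum => nu.
by apply: is_cderiveZ; apply: cdiff_is_cderive; apply: C2_cdiff_partial.
Qed.

Lemma partial_pw_mulmx F mu : C2 F ->
  partial mu (fun y => pw eta y * F (L *m y))
  = fun y => pw eta y * twisted_partial mu F (L *m y).
Proof.
move=> F2; apply/funext => x; apply: is_cderive_val.
by apply: is_cderive_pw_mulmx; apply: C2_cdiff.
Qed.

Lemma cdiff_twisted_partial F mu x : C2 F -> cdiff (twisted_partial mu F) x.
Proof.
move=> F2; apply: cdiffD.
  by apply: cdiffM (cdiff_cst _ _) _; apply: C2_cdiff.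
apply: cdiff_sum => nu.
by apply: cdiffM (cdiff_cst _ _) _; apply: C2_cdiff_partial.
Qed.

Lemma gradient_pw_mulmx F x : C2 F ->
  gradient (fun y => pw eta y * F (L *m y)) x
  = pw eta x *: (F (L *m x) *: e + (toC L)^T *m gradient F (L *m x)).
Proof.
move=> F2; apply/colP => mu; rewrite mxE partial_pw_mulmx //.
rewrite [RHS]mxE /twisted_partial; congr (_ * _); rewrite [RHS]mxE.
congr (_ + _); first by rewrite [RHS]mxE mulrC.
rewrite [RHS]mxE; by apply: eq_bigr => nu _; rewrite !mxE.
Qed.

Lemma hessian_pw_mulmx F x (G := (toC L)^T *m gradient F (L *m x)) : C2 F ->
  hessian (fun y => pw eta y * F (L *m y)) x
  = pw eta x *: (F (L *m x) *: (e *m e^T) + e *m G^T + G *m e^T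
                 + (toC L)^T *m hessian F (L *m x) *m toC L).
Proof.
move=> F2; apply/matrixP => mu nu; rewrite mxE partial_pw_mulmx //.
have -> : partial mu (fun y => pw eta y * twisted_partial nu F (L *m y)) x
    = pw eta x * twisted_partial mu (twisted_partial nu F) (L *m x).
  exact/is_cderive_val/is_cderive_pw_mulmx/cdiff_twisted_partial.
have GE rho : G rho 0 = \sum_si (L si rho)%:C * partial si F (L *m x).
  by rewrite mxE; apply: eq_bigr => si _; rewrite !mxE.
have outer (u v : 'cV[C]_(1 + 3)) i j : (u *m v^T) i j = u i 0 * v j 0.
  by rewrite mxE big_ord1 mxE.
rewrite [RHS]mxE; congr (_ * _).
have addE (M M' : 'M[C]_(1 + 3)) i j : (M + M') i j = M i j + M' i j.
  by rewrite mxE.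
have scaleE a (M : 'M[C]_(1 + 3)) i j : (a *: M) i j = a * M i j.
  by rewrite mxE.
rewrite !addE scaleE !outer !GE /twisted_partial.
rewrite mulrDr -!addrA.
congr (_ + _); first ring.
congr (_ + _).
under eq_bigr => si _.
  rewrite [X in _ * X](is_cderive_val (is_cderive_twisted_partial nu _ _ F2)).
  rewrite mulrDr mulrCA; over.
rewrite big_split /= -mulr_sumr mulrC; congr (_ + _).
rewrite mxE; under [LHS]eq_bigr do rewrite mulr_sumr.
rewrite exchange_big; apply: eq_bigr => ta _; rewrite mxE mulr_suml.
by apply: eq_bigr => si _; rewrite !mxE /partial; ring.
Qed.

End Transform.
End WaveOperator.

(** * Lorentz matrices and the covariance of the equation *)

Section Lorentz.
Set Implicit Arguments.
Unset Strict Implicit.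
Context {R : realType}.
Local Notation C := (R[i]).
Local Notation eta := (@minkowski R).
Local Notation e0 := (delta_mx 0 0 : 'rV[R]_(1 + 3)).

Definition lorentz (L : 'M[R]_(1 + 3)) : Prop := L^T *m eta *m L = eta.

Definition lorentz_inv (L : 'M[R]_(1 + 3)) := eta *m L^T *m eta.

Lemma delta_col_mx (K : nzRingType) :
  (delta_mx 0 0 : 'cV[K]_(1 + 3)) = col_mx 1%:M 0.
Proof.
by apply/colP => i; rewrite !mxE; case: splitP => j; rewrite !mxE ?ord1 -val_eqE /= => ->.
Qed.

Lemma minkowski_tr : eta^T = eta.
Proof. by rewrite /minkowski tr_block_mx !trmx0 trmx1 linearN /= trmx1. Qed.

Lemma minkowski_sqr : eta *m eta = 1%:M.
Proof.
rewrite /minkowski mulmx_block !mul0mx !mulmx0 !addr0 mulNmx mulmxN opprK !mul1mx.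
by rewrite add0r -scalar_mx_block.
Qed.

Lemma minkowski_col : eta *m (delta_mx 0 0 : 'cV[R]_(1 + 3)) = delta_mx 0 0.
Proof.
by rewrite delta_col_mx /minkowski mul_block_col !mul0mx !mulmx0 mulmx1 !addr0.
Qed.

Lemma lorentz_inv_mul L : lorentz L -> lorentz_inv L *m L = 1%:M.
Proof.
by move=> lL; rewrite /lorentz_inv -!mulmxA (mulmxA L^T) lL minkowski_sqr.
Qed.

Lemma mul_lorentz_inv L : lorentz L -> L *m lorentz_inv L = 1%:M.
Proof. by move=> /lorentz_inv_mul /mulmx1C. Qed.

Lemma lorentz_inv_tr L : lorentz L ->
  lorentz_inv L *m eta *m (lorentz_inv L)^T = eta.
Proof.
move=> lL; rewrite /lorentz_inv !trmx_mul trmxK !minkowski_tr.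
rewrite -!mulmxA (mulmxA eta eta) minkowski_sqr mul1mx.
rewrite (mulmxA eta L) (mulmxA L^T) (mulmxA L^T) lL.
by rewrite (mulmxA eta eta) minkowski_sqr mul1mx.
Qed.

Lemma mxtrace_outer n (g : 'M[C]_n) (u v : 'cV[C]_n) :
  \tr (g *m (u *m v^T)) = (v^T *m g *m u) 0 0.
Proof. by rewrite mulmxA mxtrace_mulC mulmxA /mxtrace big_ord1. Qed.

(** The algebraic core of covariance. Terms in the Hessian [H] match because [L] preserves [g]; the
    cross terms add 2 L g e to the first-order coefficient, which must restore [b]; the terms in [F]
    alone must cancel. *)
Lemma trace_transform n (g L H : 'M[C]_n) (e G b : 'cV[C]_n) (F f : C) :
  g^T = g -> L *m g *m L^T = g -> 2 *: (L *m g *m e) + L *m b = b ->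
  (e^T *m g *m e) 0 0 + (b^T *m e) 0 0 = 0 ->
  \tr (g^T *m (F *: (e *m e^T) + e *m (L^T *m G)^T + (L^T *m G) *m e^T
               + L^T *m H *m L))
    + (b^T *m (F *: e + L^T *m G)) 0 0 + f * F
  = \tr (g^T *m H) + (b^T *m G) 0 0 + f * F.
Proof.
move=> gT gL bL eb; rewrite gT; congr (_ + _).
have addE (M M' : 'M[C]_1) : (M + M') 0 0 = M 0 0 + M' 0 0 by rewrite mxE.
have scaleE a (M : 'M[C]_1) : (a *: M) 0 0 = a * M 0 0 by rewrite mxE.
rewrite !mulmxDr !mxtraceD -scalemxAr mxtraceZ !mxtrace_outer.
rewrite !mulmxA mxtrace_mulC !mulmxA gL.
rewrite addE -scalemxAr scaleE trmx_mul trmxK -!mulmxA.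
have swap (u v : 'cV[C]_n) : (u^T *m v) 0 0 = (v^T *m u) 0 0.
  by rewrite !mxE; apply: eq_bigr => i _; rewrite !mxE mulrC.
have -> : (G^T *m (L *m (g *m e))) 0 0 = (e^T *m (g *m (L^T *m G))) 0 0.
  by rewrite swap !trmx_mul gT -!mulmxA.
have bG : (b^T *m G) 0 0
    = 2 * (e^T *m (g *m (L^T *m G))) 0 0 + (b^T *m (L^T *m G)) 0 0.
  rewrite -{1}bL linearD linearZ /= !trmx_mul gT mulmxDl -scalemxAl addE scaleE.
  by rewrite -!mulmxA.
rewrite bG -!mulmxA in eb *.
move: eb => /eqP; rewrite addr_eq0 => /eqP ->; ring.
Qed.

Lemma scale_quadratic (K : comNzRingType) n (a b : K) (g : 'M[K]_n) (w w' : 'cV[K]_n) :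
  ((a *: w)^T *m g *m (a *: w)) 0 0 + ((b *: w')^T *m (a *: w)) 0 0
  = a ^+ 2 * (w^T *m g *m w) 0 0 + b * a * (w'^T *m w) 0 0.
Proof.
have scaleE k (M : 'M[K]_1) : (k *: M) 0 0 = k * M 0 0 by rewrite mxE.
have trZ k (u : 'cV[K]_n) : (k *: u)^T = k *: u^T by rewrite linearZ.
by rewrite !trZ -!scalemxAl -!scalemxAr !scaleE !mulrA -expr2.
Qed.

(** [e] and [L^T *m e] have the same [g]-norm, so the square of their difference is twice the
    difference between that norm and their product. *)
Lemma shift_quadratic n (g L : 'M[C]_n) (e : 'cV[C]_n) (u := e - L^T *m e) :
  g^T = g -> g *m e = e -> L *m g *m L^T = g ->
  (u^T *m g *m u) 0 0 = 2 * (e^T *m u) 0 0.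
Proof.
move=> gT ge gL.
have eg : e^T *m g = e^T by rewrite -{1}gT -trmx_mul ge.
have oppE (M M' : 'M[C]_1) : (M - M') 0 0 = M 0 0 - M' 0 0 by rewrite !mxE.
have uT : u^T = e^T - e^T *m L by rewrite /u linearB /= trmx_mul trmxK.
have uTg : u^T *m g = e^T - e^T *m L *m g by rewrite uT mulmxBl eg.
have Lgu : e^T *m L *m g *m u = e^T *m L *m e - e^T *m e.
  rewrite mulmxBr -[e^T *m L *m g *m e]mulmxA ge; congr (_ - _).
  have -> : e^T *m e = e^T *m (L *m g *m L^T) *m e by rewrite gL eg.
  by rewrite !mulmxA.
have -> : u^T *m g *m u = (e^T *m e - e^T *m (L^T *m e))
    - (e^T *m L *m e - e^T *m e).
  by rewrite uTg mulmxBl Lgu mulmxBr.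
have -> : e^T *m u = e^T *m e - e^T *m (L^T *m e) by rewrite mulmxBr.
have swap : (e^T *m L *m e) 0 0 = (e^T *m (L^T *m e)) 0 0.
  by rewrite -[RHS](mxE trmx_key (fun i j => (e^T *m (L^T *m e)) j i))
    -/(trmx _) !trmx_mul !trmxK.
rewrite !oppE swap; ring.
Qed.

Context (hbar c m : R).

(** The inverse of the reduced Compton wavelength. *)
Definition kappa : R := m * c / hbar.

Definition frame_shift (L : 'M[R]_(1 + 3)) : 'rV[R]_(1 + 3) :=
  kappa *: (e0 *m L - e0).

(** The cocycle identity behind the composition of boost factors: differences of x^0 telescope
    across three frames. *)
Lemma frame_shift_mul L1 L2 :
  frame_shift (L1 *m L2) = frame_shift L1 *m L2 + frame_shift L2.
Proof.
rewrite /frame_shift -scalemxAl -scalerDr mulmxBl mulmxA.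
by rewrite addrA subrK.
Qed.

Lemma wave_op_lcse_transform V L Psi Psi' : lorentz L -> C2 Psi' ->
  (forall x, Psi (L *m x) = pw (frame_shift L) x * Psi' x) ->
  forall x, wave_op (lcse hbar c m V) Psi (L *m x)
    = pw (frame_shift L) x * wave_op (lcse hbar c m (fun y => V (L *m y))) Psi' x.
Proof.
move=> lL Psi'2 PsiL x; pose Li := lorentz_inv L.
have LiL := lorentz_inv_mul lL; have LLi := mul_lorentz_inv lL.
(* The phase of [frame_shift L] read in the coordinates of S, so that [Psi] becomes a plane wave
   times [Psi'] after the linear substitution L^-1. *)
pose z := kappa *: (e0 - e0 *m Li).
have -> : Psi = fun y => pw z y * Psi' (Li *m y).
  apply/funext => y; rewrite -{1}[y]mul1mx -LLi -mulmxA PsiL pw_mulmx.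
  by rewrite /frame_shift -scalemxAl mulmxBl -mulmxA LLi mulmx1.
have zL : pw z (L *m x) = pw (frame_shift L) x.
  by rewrite pw_mulmx /z -scalemxAl mulmxBl -mulmxA LiL mulmx1.
have LiLx : Li *m (L *m x) = x by rewrite mulmxA LiL mul1mx.
rewrite !wave_op_mx gradient_pw_mulmx // hessian_pw_mulmx // LiLx zL.
rewrite -scalemxAr mxtraceZ -scalemxAr [X in _ + X + _]mxE mulrCA -!mulrDr.
congr (_ * _); rewrite [LHS]addrAC [RHS]addrAC.
set f := coef0 _ _; rewrite -/f /lcse /=.
have -> : map_mx (fun a : R => a%:C) eta = toC eta by [].
have gE0 : toC eta *m delta_mx 0 0 = delta_mx 0 0 :> 'cV[C]_(1 + 3).
  by rewrite -toC_delta -toC_mul minkowski_col.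
have gL : toC Li *m toC eta *m (toC Li)^T = toC eta.
  by rewrite -toC_tr -!toC_mul lorentz_inv_tr.
have zE : toC z^T = kappa%:C *: (delta_mx 0 0 - (toC Li)^T *m delta_mx 0 0).
  rewrite /z linearZ toCZ /= linearB /= toCB trmx_mul toC_mul trmx_delta.
  by rewrite toC_delta toC_tr.
have kap : (2 * m * c / hbar)%:C = 2 * kappa%:C :> C.
  by rewrite (_ : 2 * m * c / hbar = 2 * kappa) ?rmorphM ?rmorph_nat // /kappa; ring.
rewrite kap zE [LHS]addrAC [RHS]addrAC; apply: trace_transform => //.
- by rewrite -toC_tr minkowski_tr.
- rewrite -!scalemxAr mulmxBr mulmxA gL -mulmxA gE0 !scalerA scalerBr.
  have -> : - 'i%C * (2 * kappa%:C) = - (2 * ('i%C * kappa%:C)) :> C by ring.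
  rewrite !scaleNr. by rewrite addrAC subrr add0r.
- rewrite scalerA; set u := delta_mx 0 0 - _.
  have gT : (toC eta)^T = toC eta by rewrite -toC_tr minkowski_tr.
  have quad := shift_quadratic gT gE0 gL.
  rewrite scale_quadratic quad -/u; ring.
Qed.
End Lorentz.

(** * Boosts, four-velocities and matter waves *)

Section Boosts.
Set Implicit Arguments.
Unset Strict Implicit.
Context {R : realType}.
Local Notation C := (R[i]).
Local Notation eta := (@minkowski R).
Local Notation e0 := (delta_mx 0 0 : 'rV[R]_(1 + 3)).
Implicit Types (u v w r : vec3 R).

Lemma ord0_lshift : (0 : 'I_(1 + 3)) = lshift 3 0.
Proof. exact/val_inj. Qed.

Lemma delta_row_mx : e0 = row_mx 1%:M 0.
Proof.
by apply: trmx_inj; rewrite trmx_delta delta_col_mx tr_row_mx trmx1 trmx0.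
Qed.

Lemma dot_ge0 v : 0 <= dot v v.
Proof. by apply: sumr_ge0 => i _; rewrite -expr2 sqr_ge0. Qed.

Lemma speed_sqr v : speed v ^+ 2 = dot v v.
Proof. by rewrite sqr_sqrtr ?dot_ge0. Qed.

Lemma speed_ge0 v : 0 <= speed v. Proof. exact: sqrtr_ge0. Qed.

Lemma dot_mx u v : u^T *m v = (dot u v)%:M.
Proof.
rewrite [LHS]mx11_scalar; congr (_%:M); rewrite mxE.
by apply: eq_bigr => i _; rewrite mxE.
Qed.

Lemma dotC u v : dot u v = dot v u.
Proof. by apply: eq_bigr => i _; rewrite mulrC. Qed.

Lemma dotDl u v w : dot (u + v) w = dot u w + dot v w.
Proof.
by rewrite /dot -big_split; apply: eq_bigr => i _; rewrite mxE mulrDl.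
Qed.

Lemma dotZl a u v : dot (a *: u) v = a * dot u v.
Proof. by rewrite /dot mulr_sumr; apply: eq_bigr => i _; rewrite mxE mulrA. Qed.

Lemma dotDr u v w : dot w (u + v) = dot w u + dot w v.
Proof. by rewrite dotC dotDl !(dotC _ w). Qed.

Lemma dotZr a u v : dot u (a *: v) = a * dot u v.
Proof. by rewrite dotC dotZl dotC. Qed.

Lemma dot_eq0 v : dot v v = 0 -> v = 0.
Proof.
move=> /eqP; rewrite psumr_eq0 => [/allP v0|i _]; last by rewrite -expr2 sqr_ge0.
apply/colP => i; have := v0 i (mem_index_enum i).
by rewrite -expr2 sqrf_eq0 mxE => /eqP.
Qed.

Lemma speedZ a v : speed (a *: v) = `|a| * speed v.
Proof. by rewrite /speed dotZl dotZr mulrA -expr2 sqrtrM ?sqr_ge0 // sqrtr_sqr. Qed.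

Lemma speed0 : speed (0 : vec3 R) = 0.
Proof. by rewrite -(scale0r (0 : vec3 R)) speedZ normr0 mul0r. Qed.

Lemma speed_gt0 v : (0 < speed v) = (v != 0).
Proof.
rewrite lt0r speed_ge0 andbT; congr (~~ _); apply/eqP/eqP => [v0|->].
  by apply: dot_eq0; rewrite -speed_sqr v0 expr0n.
exact: speed0.
Qed.

Context (c : R) (c_gt0 : 0 < c).

Let c0 : c != 0. Proof. by rewrite gt_eqF. Qed.

Lemma subluminal0 : subluminal c (0 : vec3 R).
Proof. by rewrite /subluminal speed0. Qed.

Section Gamma.
Variables (v : vec3 R) (vc : subluminal c v).

Let b2 : 0 <= (speed v / c) ^+ 2 < 1.
Proof.
rewrite sqr_ge0 expr_lt1 // ?divr_ge0 ?speed_ge0 ?ltW //.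
by rewrite ltr_pdivrMr // mul1r.
Qed.

Lemma subluminal_dot : dot v v < c ^+ 2.
Proof. by rewrite -speed_sqr ltr_pXn2r // nnegrE ?speed_ge0 // ltW. Qed.

Lemma gamma_sqr : gamma c v ^+ 2 * (1 - (speed v / c) ^+ 2) = 1.
Proof.
case/andP: b2 => ? ?; rewrite /gamma exprVn sqr_sqrtr ?subr_ge0 ?ltW //.
by rewrite mulVf // gt_eqF // subr_gt0.
Qed.

Lemma gamma_gt0 : 0 < gamma c v.
Proof. by case/andP: b2 => ? ?; rewrite invr_gt0 sqrtr_gt0 subr_gt0. Qed.

Lemma gamma_ge1 : 1 <= gamma c v.
Proof.
case/andP: b2 => b20 _; rewrite -[leLHS]invr1 lef_pV2 ?posrE //.
  rewrite -[leRHS]sqrtr1 ler_wsqrtr // gerBl //.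
by have := gamma_gt0; rewrite invr_gt0.
Qed.

Lemma gamma_dot : gamma c v ^+ 2 * dot v v = (gamma c v ^+ 2 - 1) * c ^+ 2.
Proof.
have := gamma_sqr; rewrite expr_div_n speed_sqr => g1.
rewrite -[X in _ - X]g1; field.
by [].
Qed.

(** At [v = 0] the quotient is 0 by convention and the identity survives because [gamma] is then
    1. *)
Lemma gamma_coef : (gamma c v - 1) / speed v ^+ 2 * dot v v = gamma c v - 1.
Proof.
have [v0|v0] := eqVneq (dot v v) 0.
  have := gamma_sqr; rewrite expr_div_n speed_sqr v0 !mul0r subr0 !mulr1 mulr0.
  move=> /eqP; rewrite sqrf_eq1 => /orP[/eqP->|/eqP g1]; first by rewrite subrr.
  by have := gamma_gt0; rewrite g1 oppr_gt0 ltr10.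
by rewrite speed_sqr divfK.
Qed.

Let g := gamma c v.
Let q := (g - 1) / speed v ^+ 2.
Let N : 'M[R]_3 := 1%:M + q *: (v *m v^T).

Lemma boost_space_col : N *m v = g *: v.
Proof.
rewrite mulmxDl mul1mx -scalemxAl -mulmxA dot_mx mul_mx_scalar scalerA.
by rewrite gamma_coef -[X in X + _]scale1r -scalerDl addrC subrK.
Qed.

Lemma boost_space_tr : N^T = N.
Proof. by rewrite linearD linearZ /= trmx1 trmx_mul trmxK. Qed.

(** Its rank-one term is the one that the mixed blocks of the boost cancel in L^T eta L. *)
Lemma boost_space_sqr : N *m N = 1%:M + (g / c) ^+ 2 *: (v *m v^T).
Proof.
rewrite {2}/N mulmxDr mulmx1 -scalemxAr mulmxA boost_space_col -scalemxAl.
rewrite /N scalerA -addrA -scalerDl; congr (_ + _).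
have [v0|v0] := eqVneq (dot v v) 0; first by rewrite (dot_eq0 v0) mul0mx !scaler0.
congr (_ *: _); rewrite /q speed_sqr expr_div_n.
have := gamma_dot; rewrite -/g => gd.
have -> : g ^+ 2 / c ^+ 2 = g ^+ 2 * dot v v / (dot v v * c ^+ 2).
  by field; apply/andP.
by rewrite gd; field; apply/andP.
Qed.

Lemma boost_tr : (boost_mx c v)^T = boost_mx c v.
Proof.
rewrite /boost_mx tr_block_mx tr_scalar_mx boost_space_tr.
by rewrite !linearZ /= trmxK.
Qed.

Lemma boost_lorentz : lorentz (boost_mx c v).
Proof.
have gd := gamma_dot; rewrite -/g in gd.
rewrite /lorentz boost_tr /boost_mx /minkowski !mulmx_block.
rewrite !mulmx0 !mulmx1 !mulmxN !mulmx1 !addr0 !add0r -/g -/q -/N.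
rewrite !mulNmx -!scalemxAl -!scalemxAr boost_space_col.
have vN : v^T *m N = g *: v^T.
  by apply: trmx_inj; rewrite trmx_mul boost_space_tr trmxK boost_space_col linearZ /= trmxK.
rewrite vN. rewrite boost_space_sqr dot_mx.
rewrite -scalar_mxM !scale_scalar_mx mul_scalar_mx mul_mx_scalar !scalerA.
congr block_mx; rewrite ?subrr //; last by rewrite -expr2 opprD addrCA subrr addr0.
rewrite -raddfB /= mulrA -expr2 -expr2; congr (_%:M).
by rewrite expr_div_n mulrAC gd; field.
Qed.

End Gamma.

Lemma delta_boost v :
  e0 *m boost_mx c v = row_mx (gamma c v)%:M ((gamma c v / c) *: v^T).
Proof.
by rewrite delta_row_mx /boost_mx mul_row_block !mul1mx !mul0mx !addr0.
Qed.

Lemma rot_lorentz (M : 'M[R]_3) : is_rotation M -> lorentz (rot_mx M).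
Proof.
move=> [MM _]; rewrite /lorentz /rot_mx /minkowski tr_block_mx !mulmx_block.
rewrite !trmx0 !mulmx0 !mul0mx !addr0 !add0r trmx1 !mul1mx mulmxN mulmx1.
by rewrite mulNmx mul0mx mulmx1 trmxK MM.
Qed.

Lemma delta_rot (M : 'M[R]_3) : e0 *m rot_mx M = e0.
Proof.
by rewrite delta_row_mx /rot_mx mul_row_block !mul1mx !mul0mx !addr0.
Qed.

Lemma mul_row_event a (k : vec3 R) (x : spacetime R) :
  (row_mx a%:M k^T *m x) 0 0 = a * x 0 0 + dot k (space_of x).
Proof.
rewrite -{1}[x]vsubmxK mul_row_col mul_scalar_mx dot_mx.
by rewrite !mxE eqxx mulr1n -ord0_lshift.
Qed.

Context (hbar m : R) (hbar_gt0 : 0 < hbar) (m_gt0 : 0 < m).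
Let hbar0 : hbar != 0. Proof. by rewrite gt_eqF. Qed.
Local Notation kappa := (kappa hbar c m).
Local Notation frame_shift := (frame_shift hbar c m).

Lemma frame_shift_rot (M : 'M[R]_3) : frame_shift (rot_mx M) = 0.
Proof. by rewrite /frame_shift delta_rot subrr scaler0. Qed.

Lemma frame_shift_boost v :
  frame_shift (boost_mx c v)
  = row_mx (kappa * (gamma c v - 1))%:M ((kappa * gamma c v / c) *: v)^T.
Proof.
rewrite /frame_shift delta_boost delta_row_mx opp_row_mx add_row_mx oppr0 addr0.
rewrite -raddfB /= scale_row_mx scale_scalar_mx scalerA linearZ /=.
by rewrite mulrA.
Qed.

Lemma lcse_factor_pw v :
  lcse_factor hbar c m v = pw (frame_shift (boost_mx c v)).
Proof.
apply/funext => x; rewrite /lcse_factor /pw frame_shift_boost mul_row_event.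
rewrite dotZl /time_of /kappa; congr (cexp (_ * _%:C)).
by field; apply/andP.
Qed.

Lemma matter_wave_pw E (p : vec3 R) :
  matter_wave hbar c E p = pw (row_mx (- (E / (hbar * c)))%:M (hbar^-1 *: p)^T).
Proof.
apply/funext => x; rewrite /matter_wave /plane_wave /pw mul_row_event.
rewrite !dotZl /time_of; congr (cexp (_ * _%:C)).
by field; apply/andP.
Qed.

(* the four-velocity divided by c *)
Definition four_velocity u : spacetime R :=
  col_mx (gamma c u)%:M ((gamma c u / c) *: u).

Lemma four_velocity_norm u : subluminal c u ->
  ((four_velocity u)^T *m eta *m four_velocity u) = 1%:M.
Proof.
move=> uc; rewrite /four_velocity /minkowski tr_col_mx mul_row_block.
rewrite !mulmx0 addr0 add0r mulmx1 mulmxN mulmx1 mul_row_col mulNmx.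
rewrite !linearZ /= -scalemxAl dot_mx tr_scalar_mx -scalar_mxM !scale_scalar_mx.
rewrite scalerN scale_scalar_mx -raddfB /= mulrA -!expr2 expr_div_n mulrAC gamma_dot //.
by congr (_%:M); field.
Qed.

Lemma event_four_velocity u : subluminal c u ->
  four_velocity u = (gamma c u / c) *: event c 1 u.
Proof.
move=> uc; rewrite /four_velocity /event scale_col_mx scale_scalar_mx mulr1.
by rewrite divfK.
Qed.

(** [velocity_map] only says that the two vectors are proportional. Equal Minkowski norms make the
    ratio 1 or -1, and the positive time component selects 1. *)
Lemma four_velocity_map L u w : lorentz L -> subluminal c u -> subluminal c w ->
  0 < (L *m four_velocity u) 0 0 -> velocity_map c L u w ->
  L *m four_velocity u = four_velocity w.
Proof.
move=> lL uc wc pos [s Lu].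
have g0 := gamma_gt0 wc.
pose k := gamma c u / c * s / (gamma c w / c).
have Luk : L *m four_velocity u = k *: four_velocity w.
  rewrite !event_four_velocity // -scalemxAr Lu !scalerA; congr (_ *: _).
  by rewrite /k divfK // gt_eqF // divr_gt0.
have k2 : k ^+ 2 = 1.
  have := four_velocity_norm uc; rewrite -lL !mulmxA -trmx_mul -mulmxA Luk.
  rewrite -scalemxAr linearZ /= -!scalemxAl four_velocity_norm // scalerA -expr2.
  by move=> /matrixP/(_ 0 0); rewrite !mxE eqxx mulr1 => ->.
have k0 : 0 < k.
  move: pos; rewrite Luk mxE ord0_lshift /four_velocity col_mxEu mxE eqxx mulr1n.
  by rewrite pmulr_lgt0.
have -> : L *m four_velocity u = k *: four_velocity w by [].
move/eqP: k2; rewrite sqrf_eq1 => /orP[/eqP->|/eqP k1]; first by rewrite scale1r.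
by move: k0; rewrite k1 oppr_gt0 ltr10.
Qed.

(** The covector of the full four-momentum with the rest energy taken out, which is the term
    [kappa *: e0]. *)
Lemma kinetic_wave_pw u : matter_wave hbar c (kinetic_energy c m u) (momentum c m u)
  = pw (kappa *: (e0 - (four_velocity u)^T *m eta)).
Proof.
rewrite matter_wave_pw; congr pw.
rewrite /four_velocity /minkowski tr_col_mx mul_row_block !mulmx0 addr0 add0r.
rewrite mulmx1 mulmxN mulmx1 delta_row_mx opp_row_mx add_row_mx opprK add0r.
rewrite tr_scalar_mx -raddfB /= scale_row_mx scale_scalar_mx.
congr row_mx.
  by congr (_%:M); rewrite /kinetic_energy /kappa; field; apply/andP.
rewrite /momentum !linearZ /= !scalerA; congr (_ *: _).
by rewrite /kappa; field; apply/andP.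
Qed.

(** The four-momentum transforms linearly; the rest energy that was taken out in each frame leaves
    the mismatch kappa ((L x)^0 - x^0), which is the phase of [frame_shift L]. *)
Lemma kinetic_wave_transform L u w x : lorentz L ->
  subluminal c u -> subluminal c w ->
  0 < (L *m four_velocity u) 0 0 -> velocity_map c L u w ->
  pw (frame_shift L) x
    * matter_wave hbar c (kinetic_energy c m u) (momentum c m u) x
  = matter_wave hbar c (kinetic_energy c m w) (momentum c m w) (L *m x).
Proof.
move=> lL uc wc pos vL; rewrite !kinetic_wave_pw -pwD pw_mulmx; congr (pw _ x).
rewrite /frame_shift -scalerDr -scalemxAl mulmxBl -(four_velocity_map lL uc wc pos vL).
by rewrite trmx_mul -!mulmxA (mulmxA L^T) lL addrA subrK.
Qed.

End Boosts.

(** * The covariant equation and its factor satisfy all the requirements *)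

Section Compatibility.
Set Implicit Arguments.
Unset Strict Implicit.
Context {R : realType}.
Local Notation C := (R[i]).
Local Notation eta := (@minkowski R).
Local Notation e0 := (delta_mx 0 0 : 'rV[R]_(1 + 3)).
Implicit Types (u v w r : vec3 R) (z : 'rV[R]_(1 + 3)).

Lemma symbol_mx (W : wave_eq R) z x (e := 'i%C *: toC z^T : 'cV[C]_(1 + 3)) :
  symbol W z x = (e^T *m coef2 W *m e) 0 0 + ((coef1 W)^T *m e) 0 0 + coef0 W x.
Proof.
have eE mu : e mu 0 = 'i%C * (z 0 mu)%:C by rewrite mxE toCE mxE.
rewrite /symbol; congr (_ + _ + _).
  rewrite mxE exchange_big; apply: eq_bigr => nu _.
  rewrite mxE mulr_suml; apply: eq_bigr => mu _.
  by rewrite [e^T]/trmx mxE !eE; ring.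
by rewrite mxE; apply: eq_bigr => mu _; rewrite mxE eE.
Qed.

Context (hbar c m : R) (hbar_gt0 : 0 < hbar) (c_gt0 : 0 < c) (m_gt0 : 0 < m).
Let hbar0 : hbar != 0. Proof. by rewrite gt_eqF. Qed.
Let c0 : c != 0. Proof. by rewrite gt_eqF. Qed.
Let m0 : m != 0. Proof. by rewrite gt_eqF. Qed.
Local Notation kappa := (kappa hbar c m).
Local Notation frame_shift := (frame_shift hbar c m).
Local Notation lcse := (lcse hbar c m).
Local Notation kinetic_wave u :=
  (matter_wave hbar c (kinetic_energy c m u) (momentum c m u)).

Lemma kappa_gt0 : 0 < kappa.
Proof. by rewrite divr_gt0 ?mulr_gt0. Qed.

Lemma C2_pw1 z : C2 (pw z).
Proof.
have := C2_pw 1 z; rewrite (_ : (fun _ => _) = pw z) //.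
by apply/funext => x; rewrite mul1r.
Qed.

Lemma wave_op_pw1 (W : wave_eq R) z x :
  wave_op W (pw z) x = symbol W z x * pw z x.
Proof.
have pw1 : (fun y => 1 * pw z y) = pw z by apply/funext => y; apply: mul1r.
by rewrite -{1}pw1 wave_op_pw [1 * _]mul1r.
Qed.

Lemma symbol_lcse V z x :
  symbol (lcse V) z x
  = symbol (lcse (fun=> 0)) z x + (2 * m / hbar ^+ 2)%:C * V x.
Proof. by rewrite /symbol /= mulr0 addr0. Qed.

Lemma symbol_lcse0 x : symbol (lcse (fun=> 0)) 0 x = 0.
Proof.
rewrite symbol_mx /= mulr0 addr0 trmx0.
have -> : toC (0 : 'cV[R]_(1 + 3)) = 0 by apply/matrixP => i j; rewrite !mxE.
by rewrite scaler0 !mulmx0 !mxE addr0.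
Qed.

Lemma symbol_lcse_kappa x : symbol (lcse (fun=> 0)) (kappa *: e0) x = (kappa ^+ 2)%:C.
Proof.
rewrite symbol_mx /= mulr0 addr0.
have -> : 'i%C *: toC (kappa *: e0)^T
    = ('i%C * kappa%:C) *: delta_mx 0 0 :> 'cV[C]_(1 + 3).
  have -> : (kappa *: e0)^T = kappa *: (delta_mx 0 0 : 'cV[R]_(1 + 3)).
    by rewrite linearZ /= trmx_delta.
  by rewrite toCZ toC_delta scalerA.
rewrite scale_quadratic -mulmxA.
have -> : map_mx (fun a : R => a%:C) eta = toC eta by [].
have -> : toC eta *m delta_mx 0 0 = delta_mx 0 0 :> 'cV[C]_(1 + 3).
  by rewrite -toC_delta -toC_mul minkowski_col.
have -> : ((delta_mx 0 0 : 'cV[C]_(1 + 3))^T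
    *m (delta_mx 0 0 : 'cV[C]_(1 + 3))) 0 0 = 1.
  by rewrite trmx_delta mul_delta_mx mxE.
have -> : (2 * m * c / hbar)%:C = 2 * kappa%:C :> C.
  by rewrite (_ : 2 * m * c / hbar = 2 * kappa) ?rmorphM ?rmorph_nat // /kappa; ring.
rewrite !mulr1 rmorphXn exprMn sqr_i.
rewrite (_ : _ * ('i%C * kappa%:C) = - ('i%C ^+ 2) * 2 * kappa%:C ^+ 2); last ring.
rewrite sqr_i; ring.
Qed.

(** For the direct implication, plane waves are tested at two covectors where the free symbol takes
    the distinct values 0 and kappa^2. Subtracting the two relations determines [lam], and the
    relation at 0 then compares [V'] with [V]. *)
Lemma reads_as_lcse L V V' : lorentz L ->
  reads_as (lcse V) (lcse V') L (pw (frame_shift L)) <->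
  forall x', V' x' = V (L *m x').
Proof.
move=> lL; split=> [[lam lam0 eqlam] x'|VV'].
  have test z : pw (frame_shift L) x' * symbol (lcse (fun y => V (L *m y))) z x'
      = lam x' * symbol (lcse V') z x'.
    (* Chosen so that [Psi] composed with [L] is the factor times [pw z]. *)
    pose Psi := pw ((frame_shift L + z) *m lorentz_inv L).
    have PsiL y : Psi (L *m y) = pw (frame_shift L) y * pw z y.
      by rewrite -pwD /Psi pw_mulmx -mulmxA lorentz_inv_mul // mulmx1.
    have := eqlam _ _ (C2_pw1 _) (C2_pw1 z) PsiL x'.
    rewrite (wave_op_lcse_transform _ lL (C2_pw1 z) PsiL) !wave_op_pw1 !mulrA.
    by move/(mulIf (pw_neq0 _ _)).
  have := test 0; have := test (kappa *: e0).
  rewrite !(symbol_lcse V') !(symbol_lcse (fun y => V _)) symbol_lcse0.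
  rewrite symbol_lcse_kappa !add0r !mulrDr => eq1 eq0.
  have k2 : (kappa ^+ 2)%:C != 0 :> C.
    by rewrite (inj_eq (@complexI _)) expf_neq0 // gt_eqF // kappa_gt0.
  rewrite eq0 in eq1; have lamE := mulIf k2 (addIr _ eq1).
  move: eq0; rewrite -lamE => /(mulfI (pw_neq0 _ _)).
  have h2 : (2 * m / hbar ^+ 2)%:C != 0 :> C.
    by rewrite (inj_eq (@complexI _)) gt_eqF // divr_gt0 ?mulr_gt0 ?exprn_gt0.
  by move/(mulfI h2).
exists (pw (frame_shift L)); first exact: pw_neq0.
move=> Psi Psi' _ Psi'2 PsiL x'.
have -> : V' = fun y => V (L *m y) by exact/funext.
exact: wave_op_lcse_transform.
Qed.

Lemma has_time_derivative_lcse V : has_time_derivative (lcse V).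
Proof.
left; rewrite /= !mxE !eqxx mulr1 mulf_neq0 ?oppr_eq0 ?imaginary_neq0 //.
by rewrite (inj_eq (@complexI _)) gt_eqF // divr_gt0 // !mulr_gt0.
Qed.

Lemma is_boost_factor_lcse : is_boost_factor c (lcse_factor hbar c m).
Proof.
move=> v _; rewrite lcse_factor_pw //; split; first exact: C2_pw1.
by move=> x; apply: pw_neq0.
Qed.

Lemma lorentz_covariant_lcse V :
  lorentz_covariant c (lcse V) (lcse_factor hbar c m).
Proof.
split=> [M rM|v vc].
- rewrite (_ : (fun=> 1) = pw (frame_shift (rot_mx M))).
    exact/(reads_as_lcse V (fun y => V (rot_mx M *m y)) (rot_lorentz rM)).
  by apply/funext => x; rewrite frame_shift_rot pw0.
- rewrite lcse_factor_pw //.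
  exact/(reads_as_lcse V (fun y => V (boost_mx c v *m y)) (boost_lorentz c_gt0 vc)).
Qed.

Lemma composes_lcse : composes c (lcse_factor hbar c m).
Proof.
move=> v1 v2 w v1c v2c wc vw x.
by rewrite !lcse_factor_pw // -vw frame_shift_mul pwD pw_mulmx.
Qed.

Lemma rot_event (M : 'M[R]_3) t r :
  rot_mx M *m event c t r = event c t (M^T *m r).
Proof.
by rewrite /event /rot_mx mul_block_col !mul0mx mul1mx addr0 add0r.
Qed.

Lemma velocity_map_boost0 v : subluminal c v -> velocity_map c (boost_mx c v) 0 v.
Proof.
move=> vc; exists (gamma c v); rewrite /event /boost_mx mul_block_col !mulmx0 !addr0.
rewrite mulr1 -scalar_mxM scale_col_mx scale_scalar_mx; congr col_mx.
by rewrite mul_mx_scalar scalerA mulrC divfK.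
Qed.

Lemma four_velocity_rot_pos (M : 'M[R]_3) u : subluminal c u ->
  0 < (rot_mx M *m four_velocity c u) 0 0.
Proof.
move=> uc; rewrite event_four_velocity // -scalemxAr rot_event /event.
rewrite mxE ord0_lshift col_mxEu mxE eqxx mulr1n mulr1 divfK //.
exact: gamma_gt0.
Qed.

(** The time component is a positive multiple of c^2 + v.u, and 0 <= |v + u|^2 < 2 c^2 + 2 v.u. *)
Lemma four_velocity_boost_pos v u : subluminal c v -> subluminal c u ->
  0 < (boost_mx c v *m four_velocity c u) 0 0.
Proof.
move=> vc uc; rewrite /four_velocity /boost_mx mul_block_col ord0_lshift col_mxEu.
rewrite -scalemxAl -scalemxAr dot_mx -scalar_mxM !scale_scalar_mx -raddfD /=.
rewrite mxE eqxx mulr1n.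
have gv := gamma_gt0 c_gt0 vc; have gu := gamma_gt0 c_gt0 uc.
have -> : gamma c v * gamma c u + gamma c v / c * (gamma c u / c * dot v u)
   = gamma c v * gamma c u / c ^+ 2 * (c ^+ 2 + dot v u) by field.
apply: mulr_gt0; first by apply: divr_gt0; [exact: mulr_gt0|exact: exprn_gt0].
have := dot_ge0 (v + u); rewrite dotDl !dotDr (dotC u v).
have := subluminal_dot c_gt0 vc; have := subluminal_dot c_gt0 uc.
lra.
Qed.

Lemma duality_lcse L u w : lorentz L -> subluminal c u -> subluminal c w ->
  0 < (L *m four_velocity c u) 0 0 -> velocity_map c L u w ->
  exists2 A : C, A != 0 & forall x',
    pw (frame_shift L) x' * kinetic_wave u x' = A * kinetic_wave w (L *m x').
Proof.
move=> lL uc wc pos vL; exists 1; first exact: oner_neq0.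
by move=> x'; rewrite mul1r; apply: kinetic_wave_transform.
Qed.

Lemma gamma0 : gamma c 0 = 1.
Proof. by rewrite /gamma speed0 mul0r expr0n subr0 sqrtr1 invr1. Qed.

Lemma rest_wave : kinetic_wave 0 = pw 0.
Proof.
rewrite kinetic_wave_pw // /four_velocity gamma0 scaler0.
by rewrite -delta_col_mx -{1}minkowski_tr -trmx_mul minkowski_col trmx_delta subrr scaler0.
Qed.

(** The wave of velocity [u] is the boosted rest wave. The latter is the constant 1, which solves
    the free equation, and covariance transports the solution. *)
Lemma free_kinetic_wave V u : subluminal c u ->
  forall x, wave_op (free (lcse V)) (kinetic_wave u) x = 0.
Proof.
move=> uc x; have lL := boost_lorentz c_gt0 uc.
have -> : wave_op (free (lcse V)) (kinetic_wave u) x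
    = wave_op (lcse (fun=> 0)) (kinetic_wave u) x.
  by rewrite /wave_op /= mulr0.
rewrite -[x]mul1mx -(mul_lorentz_inv lL) -mulmxA.
have uL y : kinetic_wave u (boost_mx c u *m y)
    = pw (frame_shift (boost_mx c u)) y * pw 0 y.
  rewrite -rest_wave (@kinetic_wave_transform _ c c_gt0 hbar m hbar_gt0 _ 0 u) //.
  - exact: subluminal0.
  - by apply: four_velocity_boost_pos => //; exact: subluminal0.
  - exact: velocity_map_boost0.
rewrite (wave_op_lcse_transform _ lL (C2_pw1 0) uL) wave_op_pw1.
by rewrite symbol_lcse0 mul0r mulr0.
Qed.

Lemma de_broglie_lcse V : de_broglie hbar c (lcse V) (lcse_factor hbar c m)
  (kinetic_energy c m) (momentum c m).
Proof.
split.
- by rewrite /kinetic_energy /momentum gamma0 subrr !mul0r scaler0.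
- exact: free_kinetic_wave.
- move=> M rM u w uc wc vL.
  have [A A0 AE] := duality_lcse (rot_lorentz rM) uc wc (four_velocity_rot_pos M uc) vL.
  by exists A => // x'; rewrite -AE frame_shift_rot pw0.
- move=> v vc u w uc wc vL; rewrite lcse_factor_pw //.
  apply: duality_lcse => //; first exact: boost_lorentz.
  exact: four_velocity_boost_pos.
Qed.

Lemma lcse_factor_nonconstant v : subluminal c v -> v != 0 ->
  exists x y, lcse_factor hbar c m v x != lcse_factor hbar c m v y.
Proof.
move=> vc v0; have g0 := gamma_gt0 c_gt0 vc.
have d0 : 0 < dot v v by rewrite -speed_sqr exprn_gt0 // speed_gt0.
pose k := kappa * gamma c v / c.
have k0 : 0 < k by rewrite divr_gt0 // mulr_gt0 // kappa_gt0.
(* A displacement along [v] that advances the phase by pi: the factor is 1 at the first event and -1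
   at the second. *)
exists 0, (col_mx 0 ((pi / (k * dot v v)) *: v)).
rewrite lcse_factor_pw // pw_at0 /pw frame_shift_boost mul_row_event /space_of.
rewrite col_mxKd ord0_lshift col_mxEu mxE mulr0 add0r dotZl dotZr -/k.
rewrite (_ : k * _ = pi); last by field; rewrite !gt_eqF.
rewrite cexp_imaginary cospi sinpi; apply/eqP => /(congr1 (@complex.Re _)) /=; lra.
Qed.

End Compatibility.

(** * The equation in t and r, and the limit of the potential *)

Section TimeSpace.
Set Implicit Arguments.
Unset Strict Implicit.
Context {R : realType}.
Local Notation C := (R[i]).
Implicit Types (t : R) (r : vec3 R) (F Psi V : spacetime R -> C).

(** Both sides have the same difference quotient, as [f] maps the line of direction [v] through [x]
    onto a line of direction [w]. *)
Lemma cderive_affine (E E' : normedModType R) (f : E' -> E) (F : E -> C) x v w :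
  (forall h : R, f (h *: v + x) = h *: w + f x) ->
  cderive v (fun y => F (f y)) x = cderive w F (f x).
Proof.
move=> fE; have quot (k : E -> R) :
    (fun h : R => h^-1 *: (k (f (h *: v + x)) - k (f x)))
    = (fun h : R => h^-1 *: (k (h *: w + f x) - k (f x))).
  by apply/funext => h; rewrite fE.
rewrite /cderive /derive /comp /=.
by rewrite (quot (fun y => complex.Re (F y))) (quot (fun y => complex.Im (F y))).
Qed.

Lemma event_time c t r (h : R) :
  event c (h *: 1 + t) r = h *: (c *: (delta_mx 0 0 : 'cV[R]_(1 + 3))) + event c t r.
Proof.
rewrite delta_col_mx /event !scale_col_mx add_col_mx !scaler0 add0r.
rewrite !scale_scalar_mx mulr1 -raddfD /=; congr (col_mx _%:M _).
by rewrite [h *: 1]mulr1; ring.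
Qed.

Lemma delta_rshift i : col_mx 0 (delta_mx i 0) = delta_mx (rshift 1 i) 0 :> spacetime R.
Proof.
apply/matrixP => j k; rewrite !mxE ord1 andbT; case: splitP => l jE; rewrite !mxE.
  by rewrite -val_eqE /= jE ord1.
by rewrite ?ord1 eqxx andbT -!val_eqE /= jE.
Qed.

Lemma event_space c t r i (h : R) :
  event c t (h *: (delta_mx i 0 : 'cV[R]_3) + r)
  = h *: (delta_mx (rshift 1 i) 0 : 'cV[R]_(1 + 3)) + event c t r.
Proof.
by rewrite /event -delta_rshift scale_col_mx add_col_mx scaler0 add0r.
Qed.

Lemma cderive_time c F t r : cdiff F (event c t r) ->
  cderive (1 : R^o) (fun s : R^o => F (event c s r)) t
  = c%:C * partial 0 F (event c t r).
Proof.
move=> dF; rewrite (@cderive_affine _ _ (fun s : R^o => event c s r) F t 1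
  (c *: delta_mx 0 0)); last by move=> h; apply: event_time.
rewrite cderive_sum_basis // (bigD1 0) //= big1 => [|i i0].
  by rewrite !mxE !eqxx mulr1 addr0.
by rewrite !mxE (negPf i0) mulr0 mul0r.
Qed.

Lemma d_t_in_tr c F : (forall x, cdiff F x) ->
  d_t (in_tr c F) = fun t r => c%:C * partial 0 F (event c t r).
Proof. by move=> dF; apply/funext => t; apply/funext => r; apply: cderive_time. Qed.

Lemma d_t2_in_tr c F : C2 F ->
  d_t (d_t (in_tr c F))
  = fun t r => c%:C ^+ 2 * partial 0 (partial 0 F) (event c t r).
Proof.
move=> F2; rewrite d_t_in_tr; last by move=> x; apply: C2_cdiff.
rewrite -[LHS]/(d_t (in_tr c (fun x => c%:C * partial 0 F x))).
rewrite d_t_in_tr => [|x]; last first.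
  by apply: cdiffM (cdiff_cst _ _) _; apply: C2_cdiff_partial.
apply/funext => t; apply/funext => r; rewrite expr2 -mulrA; congr (_ * _).
apply: is_cderive_val; apply: is_cderiveZ; apply: cdiff_is_cderive.
exact: C2_cdiff_partial.
Qed.

Lemma laplacian_in_tr c F t r :
  laplacian (in_tr c F) t r
  = \sum_i partial (rshift 1 i) (partial (rshift 1 i) F) (event c t r).
Proof.
have space G i : cderive (delta_mx i 0 : vec3 R) (fun q => G (event c t q))
    = fun q => partial (rshift 1 i) G (event c t q).
  by apply/funext => q; apply: cderive_affine => h; apply: event_space.
by apply: eq_bigr => i _; rewrite /in_tr space space.
Qed.

Context (hbar c m : R) (hbar_gt0 : 0 < hbar) (c_gt0 : 0 < c) (m_gt0 : 0 < m).

Lemma wave_op_lcseE V F x :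
  wave_op (lcse hbar c m V) F x
  = partial 0 (partial 0 F) x
    - \sum_i partial (rshift 1 i) (partial (rshift 1 i) F) x
    - 'i%C * (2 * m * c / hbar)%:C * partial 0 F x
    + (2 * m / hbar ^+ 2)%:C * V x * F x.
Proof.
have ent i j : map_mx (fun a : R => a%:C) minkowski i j = (minkowski i j)%:C.
  by rewrite mxE.
have ul (i j : 'I_1) : minkowski (lshift 3 i) (lshift 3 j) = 1 :> R.
  by rewrite /minkowski block_mxEul mxE !ord1.
have ur (i : 'I_1) (j : 'I_3) : minkowski (lshift 3 i) (rshift 1 j) = 0 :> R.
  by rewrite /minkowski block_mxEur mxE.
have dl (i : 'I_3) (j : 'I_1) : minkowski (rshift 1 i) (lshift 3 j) = 0 :> R.
  by rewrite /minkowski block_mxEdl mxE.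
have dr (i j : 'I_3) : minkowski (rshift 1 i) (rshift 1 j) = - (i == j)%:R :> R.
  by rewrite /minkowski block_mxEdr !mxE.
rewrite /wave_op /=; congr (_ + _ + _).
- rewrite big_split_ord /= big_ord1; congr (_ + _).
    rewrite big_split_ord /= big_ord1 big1 => [|i _].
      by rewrite ent ul mul1r addr0 -ord0_lshift.
    by rewrite ent ur mul0r.
  rewrite -sumrN; apply: eq_bigr => i _.
  rewrite big_split_ord /= big_ord1 (bigD1 i) //= big1 => [|j ji].
    by rewrite !ent dl dr eqxx rmorphN rmorph1 mulN1r mul0r add0r addr0.
  by rewrite ent dr eq_sym (negPf ji) oppr0 mul0r.
- rewrite (bigD1 0) //= big1 => [|i i0]; rewrite !mxE ?eqxx ?mulr1 ?addr0 ?mulNr //.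
  by rewrite (negPf i0) /= !(mulr0, mul0r, oppr0).
Qed.

Lemma lcse_time_space V Psi : C2 Psi -> forall t r,
  wave_op (lcse hbar c m V) Psi (event c t r) = 0 <->
  lcse_time_part hbar c m (in_tr c Psi) t r
  = hamiltonian hbar m (in_tr c V) (in_tr c Psi) t r.
Proof.
move=> Psi2 t r; rewrite /lcse_time_part /hamiltonian d_t2_in_tr // laplacian_in_tr.
rewrite d_t_in_tr; last by move=> x; apply: C2_cdiff.
rewrite wave_op_lcseE /in_tr.
move: (partial 0 (partial 0 Psi) _) (\sum_i _) (partial 0 Psi _) (V _) (Psi _).
move=> a s b v p.
have C0 (x : R) : 0 < x -> x%:C != 0.
  by move=> x0; rewrite (inj_eq (@complexI _)) gt_eqF.
have h0 := C0 _ hbar_gt0; have cc0 := C0 _ c_gt0; have mm0 := C0 _ m_gt0.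
have two0 : (2 : C) != 0 by rewrite pnatr_eq0.
rewrite !(rmorphM, fmorphV, rmorphXn, rmorph_nat) /=.
set lhs := (X in X = 0 <-> _).
set L := (X in _ <-> X = _); set H := (X in _ <-> _ = X).
(* The covariant form and the form in t and r differ by this nonzero factor, so they vanish
   together. *)
have key : L - H = - (hbar%:C ^+ 2 / (2 * m%:C)) * lhs.
  by rewrite /L /H /lhs; field; rewrite ?two0 h0 cc0 mm0.
have k0 : - (hbar%:C ^+ 2 / (2 * m%:C)) != 0.
  by rewrite oppr_eq0 mulf_neq0 ?invr_eq0 ?expf_neq0 ?mulf_neq0.
split=> [l0|LH]; first by apply/eqP; rewrite -subr_eq0 key l0 mulr0.
by apply/eqP; have /eqP := key; rewrite LH subrr eq_sym mulf_eq0 (negPf k0).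
Qed.

Lemma cvg_inv_sqr (a : R) : 0 <= a -> (fun k : R => a / k ^+ 2) @ +oo --> (0 : R).
Proof.
move=> a0; apply/cvgrPdist_lt => e e0; near=> k.
have k1 : 1 <= k by near: k; exact: nbhs_pinfty_ge.
have k0 : 0 < k by rewrite (lt_le_trans _ k1).
have ke : a / e < k by near: k; apply: nbhs_pinfty_gt; exact: num_real.
rewrite sub0r normrN ger0_norm ?divr_ge0 ?sqr_ge0 //.
rewrite ltr_pdivrMr ?exprn_gt0 //; move: ke; rewrite ltr_pdivrMr // => ke.
rewrite (lt_le_trans ke) // -subr_ge0.
rewrite (_ : e * k ^+ 2 - k * e = e * k * (k - 1)); last ring.
by rewrite mulr_ge0 ?subr_ge0 // ltW // mulr_gt0.
Unshelve. all: by end_near. Qed.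

Lemma ccvgZ (T : Type) (H : set_system T) (FH : Filter H) (F : T -> C) (l A : C) :
  ccvg H F l -> ccvg H (fun k => F k * A) (l * A).
Proof.
rewrite /ccvg => Fl.
have -> : (fun k => Normc.normc (F k * A - l * A))
    = (fun k => Normc.normc (F k - l) * Normc.normc A).
  by apply/funext => k; rewrite -mulrBl Normc.normcM.
rewrite -[X in _ --> X](mul0r (Normc.normc A)).
exact: cvgMl.
Qed.

(** Here [k] is the speed of light, and [in_tr 1] keeps the wave function independent of it. The
    second time derivative has a coefficient of order k^-2, and the Laplacian term does not depend
    on [k], so convergence of the Hamiltonian is that of the potential term. *)
Lemma potential_limit (V : R -> spacetime R -> C) (U : R -> vec3 R -> R) :
  (forall t r, ccvg +oo (fun k => in_tr k (V k) t r) (U t r)%:C) <->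
  (forall Phi : spacetime R -> C, C2 Phi ->
     let psi := in_tr 1 Phi in
     forall t r,
       ccvg +oo (fun k => lcse_time_part hbar k m psi t r)
                ('i%C * hbar%:C * d_t psi t r) /\
       ccvg +oo (fun k => hamiltonian hbar m (in_tr k (V k)) psi t r)
                (hamiltonian hbar m (fun s q => (U s q)%:C) psi t r)).
Proof.
have ham (W : R -> R -> vec3 R -> C) psi t r :
    ccvg +oo (fun k => hamiltonian hbar m (W k) psi t r)
         (hamiltonian hbar m (fun s q => (U s q)%:C) psi t r)
    <-> ccvg +oo (fun k => W k t r * psi t r) ((U t r)%:C * psi t r).
  rewrite /ccvg /hamiltonian.
  set G := (X in X @ _ --> _); set G' := (X in _ <-> X @ _ --> _).
  have -> // : G = G'.
  by apply/funext => k; rewrite /G /G' opprD addrACA subrr add0r.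
split=> [VU Phi Phi2 psi t r|HV t r]; last first.
  (* The constant wave function 1 isolates the potential. *)
  have [_ /ham] := HV _ (C2_pw1 0) t r.
  by rewrite /ccvg /in_tr pw0 mulr1; under eq_fun do rewrite mulr1.
split; last by apply/ham; apply: ccvgZ; apply: VU.
rewrite /ccvg /lcse_time_part; set D := d_t (d_t psi) t r.
have -> : (fun k : R => Normc.normc (- (hbar ^+ 2 / (2 * m * k ^+ 2))%:C * D
      + 'i%C * hbar%:C * d_t psi t r - 'i%C * hbar%:C * d_t psi t r))
    = (fun k : R => (hbar ^+ 2 / (2 * m) * Normc.normc D) / k ^+ 2).
  apply/funext => k; rewrite addrK Normc.normcM normcN normc_real.
  rewrite ger0_norm; last by rewrite divr_ge0 ?sqr_ge0 // mulr_ge0 ?sqr_ge0 // mulr_ge0 // ltW.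
  by rewrite [in LHS]invfM mulrA; ring.
apply: cvg_inv_sqr; rewrite mulr_ge0 ?normc_ge0 // divr_ge0 ?sqr_ge0 //.
by rewrite mulr_ge0 // ltW.
Qed.

End TimeSpace.

(** * The Galilean limit of the factor *)

Section GalileanLimit.
Set Implicit Arguments.
Unset Strict Implicit.
Context {R : realType}.
Local Notation C := (R[i]).
Implicit Types (u v w r : vec3 R).

Lemma continuous_dotl r : continuous (fun v => dot v r).
Proof.
move=> v; apply: differentiable_continuous.
rewrite (_ : (fun _ => _) = \sum_i ((fun w : vec3 R => w i 0) * cst (r i 0))).
  apply: differentiable_sum => i; apply: differentiableM.
    exact: differentiable_coord.
  exact: differentiable_cst.
by apply/funext => w; rewrite fct_sumE.
Qed.

Lemma continuous_dot_diag : continuous (fun v => dot v v).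
Proof.
move=> v; apply: differentiable_continuous.
rewrite (_ : (fun _ => _) =
    \sum_i ((fun w : vec3 R => w i 0) * (fun w : vec3 R => w i 0))).
  by apply: differentiable_sum => i; apply: differentiableM;
    exact: differentiable_coord.
by apply/funext => w; rewrite fct_sumE.
Qed.

Lemma dot0l r : dot 0 r = 0.
Proof. by rewrite -(scale0r 0) dotZl mul0r. Qed.

Lemma cvg_dot_diag0 : (fun v => dot v v) @ (0 : vec3 R)^' --> (0 : R).
Proof.
rewrite -[X in _ --> X](dot0l 0).
by move: (@continuous_dot_diag 0) => /continuous_withinNx.
Qed.

Lemma cvg_dotl0 r : (fun v => dot v r) @ (0 : vec3 R)^' --> (0 : R).
Proof.
rewrite -[X in _ --> X](dot0l r).
by move: (@continuous_dotl r 0) => /continuous_withinNx.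
Qed.

Context (c : R) (c_gt0 : 0 < c).
Let c0 : c != 0. Proof. by rewrite gt_eqF. Qed.

Lemma dot_subluminal v : dot v v < c ^+ 2 -> subluminal c v.
Proof.
by rewrite -speed_sqr ltr_pXn2r // nnegrE ?speed_ge0 // ltW.
Qed.

(** [gamma] is (1 - B)^(-1/2) = 1 + B/2 + 3 B^2/8 + ...; each bound is checked after squaring and
    multiplying by 1 - B, which turns it into a polynomial inequality. *)
Lemma gamma_expansion v (B := (speed v / c) ^+ 2) : subluminal c v -> B <= 1 / 2 ->
  0 <= gamma c v - 1 - B / 2 <= B ^+ 2.
Proof.
move=> vc B2; have B0 : 0 <= B by rewrite sqr_ge0.
have g2 := gamma_sqr c_gt0 vc; have g1 := gamma_ge1 c_gt0 vc.
rewrite -/B in g2; move: (gamma c v) g2 g1 => g g2 g1.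
have mono (x y : R) : 0 <= x -> 0 <= y ->
    x ^+ 2 * (1 - B) <= y ^+ 2 * (1 - B) -> x <= y.
  move=> x0 y0; rewrite ler_pM2r; last lra.
  by rewrite ler_pXn2r.
have P3 : 0 <= B ^+ 3 by rewrite exprn_ge0.
have P2 : 0 <= B ^+ 2 by rewrite exprn_ge0.
apply/andP; split.
  suff : 1 + B / 2 <= g by lra.
  apply: mono; [lra|lra|rewrite g2 -subr_ge0].
  rewrite (_ : _ - _ = 3 / 4 * B ^+ 2 + B ^+ 3 / 4); last by field.
  lra.
suff : g <= 1 + B / 2 + B ^+ 2 by lra.
apply: mono; [lra|lra|rewrite g2 -subr_ge0].
rewrite (_ : _ - _ = B ^+ 2 * (5 / 4 * (1 - B) - B ^+ 3)); last by field.
apply: mulr_ge0 => //.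
have : B ^+ 3 <= 1 / 2 * B ^+ 2 by rewrite exprS ler_wpM2r.
have : B ^+ 2 <= 1 / 2 * B by rewrite expr2 ler_wpM2r.
lra.
Qed.

Context (hbar m : R) (hbar_gt0 : 0 < hbar) (m_gt0 : 0 < m).
Let hbar0 : hbar != 0. Proof. by rewrite gt_eqF. Qed.

Lemma galilean_limit_lcse : galilean_limit hbar c m (lcse_factor hbar c m).
Proof.
exists (fun v x' => 'i%C * (hbar^-1 * ((gamma c v - 1) * m * c ^+ 2 * time_of c x'
                         + gamma c v * m * dot v (space_of x')))%:C) => // x'.
set t := time_of c x'; set r := space_of x'.
(* Dominates the quotient: the error of [gamma] is at most B^2 in the term in [t] and at most B in
   the term in [r], and one factor B = (v/c)^2 is divided out. *)
pose K v := hbar^-1 * m * (dot v v * `|t| + `|dot v r|).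
have K0 : K @ (0 : vec3 R)^' --> (0 : R).
  rewrite -[X in _ --> X](mulr0 (hbar^-1 * m)); apply: cvgMr.
  rewrite -[X in _ --> X](addr0 0); apply: cvgD.
    by rewrite -[X in _ --> X](mul0r `|t|); apply: cvgMl; exact: cvg_dot_diag0.
  by rewrite -[X in _ --> X](@normr0 _ R); apply: cvg_norm; exact: cvg_dotl0.
apply: (@squeeze_cvgr _ _ _ _ (fun=> 0) K) => //; last exact: cvg_cst.
near=> v.
have v0 : v != 0 by near: v; exact: nbhs_dnbhs_neq.
have dv : dot v v < c ^+ 2 / 2.
  near: v; apply: (cvgr_lt _ cvg_dot_diag0).
  by rewrite divr_gt0 // exprn_gt0.
have c2 : 0 < c ^+ 2 by rewrite exprn_gt0.
have vc : subluminal c v by apply: dot_subluminal; lra.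
pose B := (speed v / c) ^+ 2.
have BE : B * c ^+ 2 = dot v v by rewrite /B expr_div_n speed_sqr divfK // gt_eqF.
have B0 : 0 < B by rewrite exprn_gt0 // divr_gt0 // speed_gt0.
have B2 : B <= 1 / 2.
  by rewrite -(ler_pM2r c2) BE; lra.
have /andP[lo hi] := gamma_expansion vc B2; rewrite -/B in lo hi *.
apply/andP; split; first by rewrite divr_ge0 ?normc_ge0 // ltW.
rewrite /galilean_exponent -mulrBr -rmorphB normc_imaginary -/t -/r.
set d := dot v r.
rewrite (_ : _ - _ = hbar^-1 * m
   * ((gamma c v - 1 - B / 2) * (c ^+ 2 * t) + (gamma c v - 1) * d)); last first.
  by rewrite speed_sqr -BE; field.
have hm : 0 <= hbar^-1 * m by rewrite mulr_ge0 ?invr_ge0 // ltW.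
rewrite normrM (ger0_norm hm) ler_pdivrMr // /K -[leRHS]mulrA ler_wpM2l //.
rewrite (le_trans (ler_normD _ _)) // [leRHS]mulrDl -BE; apply: lerD.
  rewrite normrM [`|_ * t|]normrM (ger0_norm lo) (ger0_norm (ltW c2)).
  rewrite (_ : B * c ^+ 2 * `|t| * B = B ^+ 2 * (c ^+ 2 * `|t|)); last ring.
  by rewrite ler_wpM2r // mulr_ge0 // ltW.
rewrite normrM ger0_norm; last lra.
rewrite mulrC ler_wpM2l //.
have : B ^+ 2 <= 1 / 2 * B by rewrite expr2 ler_wpM2r // ltW.
lra.
Unshelve. all: by end_near. Qed.

End GalileanLimit.

(** * From the transformation of symbols to relations between coefficients *)

Section Coefficients.
Set Implicit Arguments.
Unset Strict Implicit.
Context {R : realType}.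
Local Notation C := (R[i]).
Local Notation eta := (@minkowski R).
Local Notation e0 := (delta_mx 0 0 : 'rV[R]_(1 + 3)).

Lemma trmxZ (K : nzRingType) p q (a : K) (M : 'M[K]_(p, q)) : (a *: M)^T = a *: M^T.
Proof. exact: linearZ. Qed.

Lemma trmxD (K : nzRingType) p q (M N : 'M[K]_(p, q)) : (M + N)^T = M^T + N^T.
Proof. exact: linearD. Qed.

Lemma trmxB (K : nzRingType) p q (M N : 'M[K]_(p, q)) : (M - N)^T = M^T - N^T.
Proof. exact: linearB. Qed.

(** Tests on 0, on plus and minus the basis vectors and on sums of two of them. Only the symmetric
    part of [D] is seen by a quadratic form. *)
Lemma real_quadratic_eq0 n (D : 'M[C]_n) (l : 'rV[C]_n) (f : C) :
  (forall z : 'cV[R]_n,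
    ((toC z)^T *m D *m toC z) 0 0 + (l *m toC z) 0 0 + f = 0) ->
  D + D^T = 0 /\ l = 0.
Proof.
move=> Dz.
have scaleE (a : C) (M : 'M[C]_1) : (a *: M) 0 0 = a * M 0 0 by rewrite mxE.
have addE (M M' : 'M[C]_1) : (M + M') 0 0 = M 0 0 + M' 0 0 by rewrite mxE.
have DE i j : ((delta_mx i 0 : 'cV[C]_n)^T *m D *m (delta_mx j 0 : 'cV[C]_n)) 0 0
    = D i j.
  by rewrite trmx_delta -rowE -colE !mxE.
have lE i : (l *m (delta_mx i 0 : 'cV[C]_n)) 0 0 = l 0 i by rewrite -colE mxE.
have two0 : (2 : C) != 0 by rewrite pnatr_eq0.
have line i (a : R) : a%:C ^+ 2 * D i i + a%:C * l 0 i + f = 0.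
  have := Dz (a *: delta_mx i 0); rewrite toCZ toC_delta trmxZ.
  by rewrite -!scalemxAl -!scalemxAr scalerA !scaleE DE lE -expr2.
have f0 (i : 'I_n) : f = 0 by have := line i 0; rewrite rmorph0 expr0n !mul0r !add0r.
have l0 i : l 0 i = 0.
  have := line i 1; have := line i (-1); rewrite (f0 i) rmorphN rmorph1 sqrrN.
  rewrite expr1n mul1r mulN1r !addr0 => e1 e2.
  apply: (mulfI two0); rewrite mulr0 -[RHS](subrr (0 : C)) -{1}e2 -e1; ring.
have D0 i : D i i = 0.
  by have := line i 1; rewrite (f0 i) l0 rmorph1 expr1n mul1r mulr0 !addr0.
split; last by apply/rowP => i; rewrite l0 mxE.
apply/matrixP => i j; rewrite !mxE.
have := Dz (delta_mx i 0 + delta_mx j 0).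
rewrite toCD !toC_delta trmxD mulmxDr !mulmxDl mulmxDr !addE !DE !lE.
by rewrite !l0 !D0 (f0 i) !addr0 add0r addrC.
Qed.

(** Twice the symmetric part of the second-order coefficients, the part that plane waves detect. *)
Definition sym2 (W : wave_eq R) : 'M[C]_(1 + 3) := coef2 W + (coef2 W)^T.

Lemma sym2_tr W : (sym2 W)^T = sym2 W.
Proof. by rewrite /sym2 trmxD trmxK addrC. Qed.

Lemma symbol_transform W (L : 'M[R]_(1 + 3)) A xi : lorentz L -> A != 0 ->
  reads_as W (in_frame L W) L (fun x => A * pw xi x) ->
  exists2 k : C, k != 0 & forall z,
    symbol W ((z + xi) *m lorentz_inv L) 0 = k * symbol W z 0.
Proof.
move=> lL A0 [lam lam0 lamE]; exists (lam 0 / A).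
  by rewrite mulf_neq0 ?invr_eq0 ?lam0.
move=> z; pose Psi x := A * pw ((z + xi) *m lorentz_inv L) x.
have PsiL x : Psi (L *m x) = A * pw xi x * pw z x.
  by rewrite /Psi pw_mulmx -mulmxA lorentz_inv_mul // mulmx1 pwD mulrA mulrAC.
have := lamE _ _ (C2_pw _ _) (C2_pw1 z) PsiL 0.
rewrite mulmx0 wave_op_pw wave_op_pw1 !pw_at0 !mulr1 => eqA.
have -> : symbol W z 0 = symbol (in_frame L W) z 0.
  by rewrite /symbol /= mulmx0.
by rewrite -mulrAC -eqA mulfK.
Qed.

(** Expansion of P((z + xi) L^-1) - k P(z) by degree in z. Once [L] is the inverse frame change, the
    last line is the constant term, the only one that contains f(0). *)
Lemma shift_quadratic_form n (a L : 'M[C]_n) (b X Z : 'cV[C]_n) (k f : C)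
    (a' := L *m a *m L^T) (b' := L *m b) :
  - ((L^T *m (Z + X))^T *m a *m (L^T *m (Z + X))) 0 0
    + 'i%C * (b^T *m (L^T *m (Z + X))) 0 0 + f
  - k * (- (Z^T *m a *m Z) 0 0 + 'i%C * (b^T *m Z) 0 0 + f)
  = (Z^T *m (k *: a - a') *m Z) 0 0
    + (('i%C *: (b'^T - k *: b^T) - X^T *m (a' + a'^T)) *m Z) 0 0
    + (- (X^T *m a' *m X) 0 0 + 'i%C * (b'^T *m X) 0 0 + f - k * f).
Proof.
have -> : (L^T *m (Z + X))^T *m a *m (L^T *m (Z + X)) = (Z + X)^T *m a' *m (Z + X).
  by rewrite trmx_mul trmxK /a' !mulmxA.
have -> : b^T *m (L^T *m (Z + X)) = b'^T *m (Z + X).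
  by rewrite mulmxA /b' trmx_mul.
move: a' b' => a' b'.
have scaleE (x : C) (M : 'M[C]_1) : (x *: M) 0 0 = x * M 0 0 by rewrite mxE.
have addE (M M' : 'M[C]_1) : (M + M') 0 0 = M 0 0 + M' 0 0 by rewrite mxE.
have oppE (M : 'M[C]_1) : (- M) 0 0 = - M 0 0 by rewrite mxE.
have tr1 (M : 'M[C]_1) : M^T = M by rewrite [M]mx11_scalar tr_scalar_mx.
have ZX : Z^T *m a' *m X = X^T *m a'^T *m Z.
  by rewrite -[LHS]tr1 !trmx_mul trmxK mulmxA.
have -> : (Z + X)^T *m a' *m (Z + X) = Z^T *m a' *m Z + X^T *m a' *m Z
    + (X^T *m a'^T *m Z + X^T *m a' *m X).
  by rewrite trmxD !mulmxDl !mulmxDr ZX addrACA addrA.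
have -> : Z^T *m (k *: a - a') *m Z = k *: (Z^T *m a *m Z) - Z^T *m a' *m Z.
  by rewrite mulmxBr mulmxBl -scalemxAr -scalemxAl.
have -> : ('i%C *: (b'^T - k *: b^T) - X^T *m (a' + a'^T)) *m Z
   = 'i%C *: (b'^T *m Z - k *: (b^T *m Z)) - (X^T *m a' *m Z + X^T *m a'^T *m Z).
  by rewrite mulmxBl mulmxDr mulmxDl -scalemxAl mulmxBl -scalemxAl.
rewrite mulmxDr !(addE, oppE, scaleE).
move: ((Z^T *m a *m Z) 0 0) ((Z^T *m a' *m Z) 0 0) ((X^T *m a' *m Z) 0 0).
move: ((X^T *m a'^T *m Z) 0 0) ((X^T *m a' *m X) 0 0) ((b'^T *m Z) 0 0).
move: ((b'^T *m X) 0 0) ((b^T *m Z) 0 0) => *.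
ring.
Qed.

Lemma symbol_relations W (L : 'M[R]_(1 + 3)) k xi (Li := toC (lorentz_inv L)) :
  (forall z, symbol W ((z + xi) *m lorentz_inv L) 0 = k * symbol W z 0) ->
  Li *m sym2 W *m Li^T = k *: sym2 W /\
  Li *m coef1 W + 'i%C *: (k *: (sym2 W *m toC xi^T)) = k *: coef1 W.
Proof.
move=> symk.
pose a := coef2 W; pose b := coef1 W; pose X := toC xi^T.
pose a' := Li *m a *m Li^T; pose b' := Li *m b.
pose D := k *: a - a'.
pose l := 'i%C *: (b'^T - k *: b^T) - X^T *m (a' + a'^T).
have scaleE (x : C) (M : 'M[C]_1) : (x *: M) 0 0 = x * M 0 0 by rewrite mxE.
have symE z : symbol W z 0 = - ((toC z^T)^T *m a *m toC z^T) 0 0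
     + 'i%C * (b^T *m toC z^T) 0 0 + coef0 W 0.
  rewrite symbol_mx -/a -/b trmxZ -!scalemxAl -!scalemxAr !scaleE mulrA.
  by rewrite mulii mulN1r.
have [|D0 l0] := @real_quadratic_eq0 _ D l
    (- (X^T *m a' *m X) 0 0 + 'i%C * (b'^T *m X) 0 0 + coef0 W 0 - k * coef0 W 0).
  move=> z; have := symk z^T; rewrite !symE trmxK.
  have -> : toC ((z^T + xi) *m lorentz_inv L)^T = Li^T *m (toC z + X).
    by rewrite trmx_mul trmxD trmxK toC_mul toCD toC_tr.
  set Z := toC z => /eqP; rewrite -subr_eq0 => /eqP eq0.
  by rewrite -[RHS]eq0 shift_quadratic_form.
have s' : Li *m sym2 W *m Li^T = a' + a'^T.
  by rewrite /sym2 mulmxDr mulmxDl /a' !trmx_mul trmxK !mulmxA.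
have ks : a' + a'^T = k *: sym2 W.
  move: D0; rewrite /D trmxB trmxZ addrACA -opprD -scalerDr -/a -/(sym2 W).
  by move/eqP; rewrite subr_eq0 => /eqP.
split; first by rewrite s'.
have lT : 'i%C *: (b' - k *: b) = k *: (sym2 W *m X).
  apply: trmx_inj; rewrite !trmxZ trmxB trmxZ [(sym2 W *m X)^T]trmx_mul.
  rewrite sym2_tr scalemxAr -ks.
  by apply/eqP; rewrite -subr_eq0; apply/eqP.
by rewrite -lT scalerA mulii scaleN1r opprB -/b' addrC subrK.
Qed.

End Coefficients.

(** * Consequences of rotation covariance *)

Section Isotropy.
Set Implicit Arguments.
Unset Strict Implicit.
Context {R : realType}.
Local Notation C := (R[i]).
Local Notation eta := (@minkowski R).
Local Notation e0 := (delta_mx 0 0 : 'rV[R]_(1 + 3)).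

Lemma lorentz_inv_rot (M : 'M[R]_3) :
  lorentz_inv (rot_mx M) = block_mx 1%:M 0 0 M.
Proof.
rewrite /lorentz_inv /rot_mx tr_block_mx !trmx0 trmxK trmx1 !mulmx_block.
rewrite !(mulmx0, mul0mx, addr0, add0r, mul1mx, mulmx1, mulNmx, mulmxN, opprK, oppr0).
by [].
Qed.

Lemma toC_block p1 p2 q1 q2 (A : 'M[R]_(p1, q1)) (B : 'M[R]_(p1, q2))
    (B' : 'M[R]_(p2, q1)) (D : 'M[R]_(p2, q2)) :
  toC (block_mx A B B' D) = block_mx (toC A) (toC B) (toC B') (toC D).
Proof. exact: map_block_mx. Qed.

Lemma toC0 p q : toC (0 : 'M[R]_(p, q)) = 0.
Proof. by apply/matrixP => i j; rewrite !mxE. Qed.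

(** The rotation by pi about the axis [i]. *)
Definition half_turn (i : 'I_3) : 'M[R]_3 :=
  diag_mx (\row_j (if j == i then 1 else -1)).

Lemma half_turn_rotation i : is_rotation (half_turn i).
Proof.
split.
  rewrite /half_turn tr_diag_mx mulmx_diag; apply/matrixP => j l; rewrite !mxE.
  by case: (j == i); rewrite ?mulrNN !mulr1.
rewrite det_diag (bigD1 i) //= mxE eqxx mul1r.
rewrite (eq_bigr (fun=> -1)) => [|j /negPf ji]; last by rewrite mxE ji.
by rewrite prodr_const cardC1 card_ord /= sqrrN expr1n.
Qed.

Let i1 : 'I_3 := @Ordinal 3 1 isT.
Let i2 : 'I_3 := @Ordinal 3 2 isT.

(** As a matrix, a rotation by a third of a turn about the diagonal. With the half turns it
    generates the rotation group of the tetrahedron, large enough to detect isotropy. *)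
Definition cycle3 : {perm 'I_3} := (tperm ord0 i1 * tperm i1 i2)%g.

Lemma cycle3_rotation : is_rotation (perm_mx cycle3 : 'M[R]_3).
Proof.
split; first by rewrite tr_perm_mx -perm_mxM mulgV perm_mx1.
by rewrite det_perm odd_permM !odd_tperm.
Qed.

Lemma toC_perm n (s : {perm 'I_n}) : toC (perm_mx s : 'M[R]_n) = perm_mx s.
Proof. exact: map_perm_mx. Qed.

Let ord3_ind (P : 'I_3 -> Prop) : P ord0 -> P i1 -> P i2 -> forall i, P i.
Proof.
by move=> P0 P1 P2 [[|[|[|//]]] lt3]; [move: P0|move: P1|move: P2];
  congr P; apply: val_inj.
Qed.

Let cycle3_0 : cycle3 ord0 = i2. Proof. by rewrite permM tpermL tpermL. Qed.

Let cycle3_1 : cycle3 i1 = ord0. Proof. by rewrite permM tpermR tpermD. Qed.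

Let cycle3_2 : cycle3 i2 = i1.
Proof. by rewrite permM [tperm ord0 i1 i2]tpermD // tpermR. Qed.

Lemma cycle3_neq i : cycle3 i != i.
Proof. by elim/ord3_ind: i; rewrite ?cycle3_0 ?cycle3_1 ?cycle3_2. Qed.

(** If one component is nonzero, the cyclic rotation makes another one nonzero, and the half turn
    about the first axis multiplies the two by 1 and -1: no common eigenvalue exists. *)
Lemma rotation_eigenvector (v : 'cV[C]_3) :
  (forall M, is_rotation M -> exists2 k : C, k != 0 & toC M *m v = k *: v) -> v = 0.
Proof.
move=> vM; apply/colP => j; rewrite mxE; apply/eqP/negPn/negP => vj.
have [k k0 /colP/(_ j)] := vM _ cycle3_rotation.
rewrite toC_perm -row_permE !mxE => vsj.
have {vsj} vsj : v (cycle3 j) 0 != 0 by rewrite vsj mulf_neq0.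
have [l l0 vl] := vM _ (half_turn_rotation j).
have ht i : (if i == j then 1 else -1) * v i 0 = l * v i 0.
  have := congr1 (fun w : 'cV[C]_3 => w i 0) vl.
  rewrite /toC map_diag_mx mul_diag_mx !mxE; case: ifP => _ //.
  by rewrite rmorphN rmorph1.
have := ht j; have := ht (cycle3 j); rewrite eqxx (negPf (cycle3_neq j)).
move=> /(mulIf vsj) <- /(mulIf vj) /eqP.
by rewrite -subr_eq0 opprK (_ : 1 + 1 = 2) // pnatr_eq0.
Qed.

(** Half turns change the sign of off-diagonal entries, and the cyclic rotation equates the diagonal
    ones. *)
Lemma rotation_invariant_mx (S : 'M[C]_3) :
  (forall M, is_rotation M -> toC M *m S *m (toC M)^T = S) ->
  S = (S 0 0)%:M.
Proof.
move=> SM.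
have cyc i : S (cycle3 i) (cycle3 i) = S i i.
  have := congr1 (fun M : 'M[C]_3 => M i i) (SM _ cycle3_rotation).
  by rewrite toC_perm tr_perm_mx -row_permE -col_permE !mxE.
have diag i : S i i = S 0 0.
  have S2 := cyc ord0; rewrite cycle3_0 in S2.
  have S1 := cyc i2; rewrite cycle3_2 in S1.
  by elim/ord3_ind: i; rewrite ?S1 ?S2.
apply/matrixP => i j; rewrite !mxE; case: eqVneq => [<-|ij]; first exact: diag.
have := congr1 (fun M : 'M[C]_3 => M i j) (SM _ (half_turn_rotation i)).
rewrite /toC map_diag_mx tr_diag_mx mul_diag_mx mul_mx_diag !mxE eqxx.
rewrite eq_sym (negPf ij) rmorph1 mul1r rmorphN rmorph1 mulrN1 => /eqP.
by rewrite eq_sym -addr_eq0 -mulr2n mulrn_eq0 /= => /eqP.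
Qed.

(** Covariance only gives relations up to a factor k. The mixed block and the spatial first-order
    part are eigenvectors of all rotations, hence vanish; the time derivative then has to come from
    [s0] or [b0], both fixed by rotations, which gives k = 1 and makes the spatial block
    invariant. *)
Lemma isotropic_coefficients W : has_time_derivative W ->
  (forall M, is_rotation M ->
     reads_as W (in_frame (rot_mx M) W) (rot_mx M) (fun=> 1)) ->
  exists s0 de b0 : C, [/\ sym2 W = block_mx s0%:M 0 0 de%:M,
    coef1 W = b0 *: (delta_mx 0 0 : 'cV[C]_(1 + 3)) & s0 != 0 \/ b0 != 0].
Proof.
move=> Wt cov.
have rel M : is_rotation M -> exists2 k : C, k != 0 &
    (block_mx 1%:M 0 0 (toC M) *m sym2 W *m block_mx 1%:M 0 0 (toC M)^T
       = k *: sym2 W /\ block_mx 1%:M 0 0 (toC M) *m coef1 W = k *: coef1 W).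
  move=> rM.
  have pw1 : (fun=> 1) = (fun x => 1 * pw 0 x) :> (spacetime R -> C).
    by apply/funext => x; rewrite pw0 mulr1.
  have := cov M rM; rewrite pw1 => cM.
  have [k k0 /symbol_relations] := symbol_transform (rot_lorentz rM) (oner_neq0 _) cM.
  rewrite lorentz_inv_rot toC_block !toC0 toC1 tr_block_mx trmx1 !trmx0.
  by rewrite toC0 mulmx0 !scaler0 addr0; exists k.
pose s0 := ulsubmx (sym2 W) 0 0; pose sg := dlsubmx (sym2 W).
pose S := drsubmx (sym2 W).
have sE : sym2 W = block_mx s0%:M sg^T sg S.
  rewrite -[LHS]submxK [ulsubmx _]mx11_scalar; congr block_mx.
  by rewrite /sg trmx_dlsub sym2_tr.
pose b0 := usubmx (coef1 W) 0 0; pose be := dsubmx (coef1 W).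
have bE : coef1 W = col_mx b0%:M be.
  by rewrite -[LHS]vsubmxK [usubmx _]mx11_scalar.
have {}rel M : is_rotation M -> exists2 k : C, k != 0 &
    [/\ s0 = k * s0, toC M *m sg = k *: sg, toC M *m S *m (toC M)^T = k *: S,
        b0 = k * b0 & toC M *m be = k *: be].
  move=> /rel[k k0 [ks kb]]; exists k => //.
  move: ks kb; rewrite sE bE !mulmx_block mul_block_col !mul1mx !mul0mx !mulmx0.
  rewrite !(addr0, add0r, mulmx0, mul0mx, mulmx1).
  rewrite scale_block_mx scale_col_mx !scale_scalar_mx.
  move=> /eq_block_mx[u1 _ u2 u3] /eq_col_mx[u4 u5]; split=> //.
  - by have /matrixP/(_ 0 0) := u1; rewrite !mxE.
  - by have /matrixP/(_ 0 0) := u4; rewrite !mxE.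
have sg0 : sg = 0.
  by apply: rotation_eigenvector => M /rel[k k0 [_ ? _ _ _]]; exists k.
have be0 : be = 0.
  by apply: rotation_eigenvector => M /rel[k k0 [_ _ _ _ ?]]; exists k.
have sb : s0 != 0 \/ b0 != 0.
  case: Wt => [|[mu]].
    by rewrite bE ord0_lshift col_mxEu mxE eqxx mulr1n; right.
  have -> : coef2 W 0 mu + coef2 W mu 0 = sym2 W 0 mu by rewrite !mxE.
  rewrite sE sg0 trmx0 ord0_lshift; case: (split_ordP mu) => j ->.
    by rewrite block_mxEul mxE !ord1 eqxx mulr1n; left.
  by rewrite block_mxEur mxE eqxx.
exists s0, (S 0 0), b0; split=> //.
- rewrite sE sg0 trmx0; congr block_mx; apply: rotation_invariant_mx => M /rel.
  case=> k k0 [ks _ -> kb _].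
  suff -> : k = 1 by rewrite scale1r.
  by case: sb => /mulIf; apply; rewrite mul1r.
- by rewrite bE be0 delta_col_mx scale_col_mx scale_scalar_mx mulr1 scaler0.
Qed.

End Isotropy.

(** * Consequences of boost covariance *)

Section BoostCoefficients.
Set Implicit Arguments.
Unset Strict Implicit.
Context {R : realType}.
Local Notation C := (R[i]).
Local Notation eta := (@minkowski R).
Local Notation e0 := (delta_mx 0 0 : 'rV[R]_(1 + 3)).
Local Notation E0 := (delta_mx 0 0 : 'cV[C]_(1 + 3)).
Context (c : R) (c_gt0 : 0 < c).

Lemma lorentz_inv_delta (L : 'M[R]_(1 + 3)) :
  lorentz_inv L *m (delta_mx 0 0 : 'cV[R]_(1 + 3)) = eta *m (e0 *m L)^T.
Proof.
by rewrite /lorentz_inv -mulmxA minkowski_col trmx_mul trmx_delta mulmxA.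
Qed.

Lemma boost_inv_delta (v : vec3 R) :
  lorentz_inv (boost_mx c v) *m (delta_mx 0 0 : 'cV[R]_(1 + 3))
  = col_mx (gamma c v)%:M (- ((gamma c v / c) *: v)).
Proof.
rewrite lorentz_inv_delta delta_boost tr_row_mx tr_scalar_mx trmxZ trmxK.
rewrite /minkowski mul_block_col !mul0mx mul1mx addr0 add0r.
by rewrite mulNmx mul1mx.
Qed.

Lemma toC_minkowskiE : toC eta = block_mx 1%:M 0 0 (- 1%:M).
Proof.
rewrite /minkowski toC_block !toC1 !toC0; congr block_mx.
by apply/matrixP => i j; rewrite !mxE rmorphN rmorph_nat.
Qed.

Lemma boost_coefficients W (s0 de b0 : C) :
  sym2 W = block_mx s0%:M 0 0 de%:M -> coef1 W = b0 *: E0 ->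
  s0 != 0 \/ b0 != 0 ->
  (forall v, subluminal c v -> exists A xi, A != 0 /\
     reads_as W (in_frame (boost_mx c v) W) (boost_mx c v)
       (fun x => A * pw xi x)) ->
  [/\ s0 != 0, sym2 W = s0 *: toC eta &
    forall v A xi, subluminal c v -> A != 0 ->
      reads_as W (in_frame (boost_mx c v) W) (boost_mx c v)
        (fun x => A * pw xi x) ->
      toC xi = ('i%C * b0 / s0) *: toC (e0 *m boost_mx c v - e0)].
Proof.
move=> sE bE sb cov.
(* A nonzero test velocity below c along the first axis, so that its boost mixes x^0 with x^1. *)
pose v1 : vec3 R := (c / 2) *: delta_mx 0 0.
have v1c : subluminal c v1.
  apply: dot_subluminal => //; rewrite dotZl dotZr /dot (bigD1 0) //= big1.
    by rewrite !mxE eqxx addr0 !mulr1 expr2; have := exprn_gt0 2 c_gt0; nra.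
  by move=> i /negPf i0; rewrite !mxE i0 mul0r.
have rel v A xi : subluminal c v -> A != 0 ->
    reads_as W (in_frame (boost_mx c v) W) (boost_mx c v)
       (fun x => A * pw xi x) ->
    exists2 k : C, k != 0 & (toC (lorentz_inv (boost_mx c v)) *m sym2 W
         *m (toC (lorentz_inv (boost_mx c v)))^T = k *: sym2 W /\
      toC (lorentz_inv (boost_mx c v)) *m coef1 W
         + 'i%C *: (k *: (sym2 W *m toC xi^T)) = k *: coef1 W).
  move=> vc A0 cv; have lL := boost_lorentz c_gt0 vc.
  have [k k0 /symbol_relations rk] := symbol_transform lL A0 cv.
  by exists k.
have etaL v : subluminal c v -> toC (lorentz_inv (boost_mx c v)) *m toC eta
    *m (toC (lorentz_inv (boost_mx c v)))^T = toC eta.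
  move=> vc; rewrite -toC_tr -!toC_mul lorentz_inv_tr //.
  exact: boost_lorentz.
have LE0 v : toC (lorentz_inv (boost_mx c v)) *m E0
    = toC (col_mx (gamma c v)%:M (- ((gamma c v / c) *: v))).
  by rewrite -toC_delta -toC_mul boost_inv_delta.
have outer : E0 *m E0^T = block_mx 1%:M 0 0 0.
  rewrite delta_col_mx tr_col_mx trmx1 trmx0 mul_col_row.
  by rewrite !mulmx0 !mul0mx mulmx1.
(* The Minkowski form is invariant, so a boost can only alter the time-time remainder. *)
have sE' : sym2 W = - de *: toC eta + (s0 + de) *: (E0 *m E0^T).
  rewrite sE toC_minkowskiE outer !scale_block_mx add_block_mx !scaler0 !addr0.
  rewrite !scale_scalar_mx !mulr1 -raddfD /= [_ *: - _]scalerN scaleNr opprK.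
  rewrite scale_scalar_mx mulr1; congr (block_mx _%:M _ _ _).
  by rewrite addrC addrK.
have g1 : (gamma c v1)%:C != 0 :> C.
  by rewrite (inj_eq (@complexI _)) gt_eqF // gamma_gt0.
have w1 : (- (gamma c v1 / c * (c / 2)))%:C != 0 :> C.
  rewrite (inj_eq (@complexI _)) oppr_eq0 mulf_neq0 //.
    by rewrite gt_eqF // divr_gt0 // gamma_gt0.
  by rewrite gt_eqF // divr_gt0.
pose r1 : 'I_(1 + 3) := rshift 1 0.
have L00 : (toC (lorentz_inv (boost_mx c v1)) *m E0) 0 0 = (gamma c v1)%:C.
  by rewrite LE0 toCE ord0_lshift col_mxEu mxE eqxx mulr1n.
have L10 : (toC (lorentz_inv (boost_mx c v1)) *m E0) r1 0
    = (- (gamma c v1 / c * (c / 2)))%:C.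
  by rewrite LE0 toCE /r1 col_mxEd !mxE eqxx mulr1.
have E10 : E0 r1 0 = 0 by rewrite mxE.
have eta01 : toC eta 0 r1 = 0.
  by rewrite toC_minkowskiE ord0_lshift /r1 block_mxEur mxE.
have [A [xi [A0 cv1]]] := cov _ v1c.
have [k k0 [ks kb]] := rel _ _ _ v1c A0 cv1.
have scaleE a (M : 'M[C]_(1 + 3)) i j : (a *: M) i j = a * M i j by rewrite mxE.
have eta00 : toC eta 0 0 = 1.
  by rewrite toC_minkowskiE ord0_lshift block_mxEul mxE.
(* The boosted remainder has a nonzero entry at (0, [r1]), while k times the original matrix has
   none there. *)
have sde : s0 + de = 0.
  have outerE (u : 'cV[C]_(1 + 3)) i j : (u *m u^T) i j = u i 0 * u j 0.
    by rewrite mxE big_ord1 mxE.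
  have conj (L : 'M[C]_(1 + 3)) : L *m (E0 *m E0^T) *m L^T = (L *m E0) *m (L *m E0)^T.
    by rewrite trmx_mul !mulmxA.
  have addE (M N : 'M[C]_(1 + 3)) i j : (M + N) i j = M i j + N i j by rewrite mxE.
  move: ks; rewrite sE' mulmxDr mulmxDl -!scalemxAr -!scalemxAl etaL // conj.
  move/matrixP/(_ 0 r1); rewrite scaleE !addE !scaleE !outerE L00 L10 eta01 E10.
  rewrite !mulr0 !add0r mulr0 => /eqP; rewrite !mulf_eq0 (negPf g1) (negPf w1).
  by rewrite !orbF => /eqP.
have sE2 : sym2 W = s0 *: toC eta.
  rewrite sE' sde scale0r addr0; congr (_ *: _).
  by apply/eqP; rewrite eq_sym -addr_eq0 sde.
(* Without second-order terms, the first-order vector [b0 *: E0] would have to be an eigenvector of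
   the boost, which gives it a spatial component. *)
have s00 : s0 != 0.
  case: sb => // b00; apply/eqP => s00.
  move: kb; rewrite sE2 s00 scale0r mul0mx !scaler0 addr0 bE -scalemxAr.
  move/matrixP/(_ r1 0); rewrite mxE L10 mxE [in RHS]mxE E10 !mulr0 => /eqP.
  by rewrite mulf_eq0 (negPf b00) (negPf w1).
split=> // v B z vc B0 cv.
have [l l0 [ls lb]] := rel _ _ _ vc B0 cv.
have l1 : l = 1.
  move: ls; rewrite sE2 -scalemxAr -scalemxAl etaL // scalerA.
  move/matrixP/(_ 0 0); rewrite !scaleE eta00 !mulr1 => ls.
  by apply: (mulIf s00); rewrite mul1r.
move: lb; rewrite l1 !scale1r sE2 bE -scalemxAr -scalemxAl.
have -> : toC (lorentz_inv (boost_mx c v)) *m E0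
    = toC eta *m toC (e0 *m boost_mx c v)^T.
  rewrite -toC_mul -lorentz_inv_delta toC_mul.
  by congr (_ *m _); rewrite toC_delta.
move=> lb; have eta2 : toC eta *m toC eta = 1%:M.
  by rewrite -toC_mul minkowski_sqr toC1.
have etaE : toC eta *m E0 = E0.
  by rewrite -toC_delta -toC_mul minkowski_col.
apply: trmx_inj; rewrite -toC_tr trmxZ -toC_tr trmxB trmx_delta.
have {}lb : b0 *: toC (e0 *m boost_mx c v)^T + 'i%C *: (s0 *: toC z^T) = b0 *: E0.
  have := congr1 (mulmx (toC eta)) lb.
  by rewrite mulmxDr -!scalemxAr !mulmxA eta2 !mul1mx etaE.
rewrite toCB toC_delta; move: (toC z^T) (toC (e0 *m _)^T) lb => X Y lb.
have is0 : 'i%C * s0 != 0 by rewrite mulf_neq0 ?imaginary_neq0.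
apply: (scalerI is0); rewrite -scalerA (_ : 'i%C *: _ = b0 *: E0 - b0 *: Y).
  rewrite scalerA (_ : _ * ('i%C * b0 / s0) = - b0).
    by rewrite scaleNr -scalerN opprB scalerBr.
  rewrite (_ : _ * _ = 'i%C * 'i%C * (b0 * (s0 / s0))); last by field.
  by rewrite mulii divff // mulr1 mulN1r.
by rewrite -lb addrC addKr.
Qed.

End BoostCoefficients.

(** * Plane-wave form of the factor and determination of its parameter *)

Section Uniqueness.
Set Implicit Arguments.
Unset Strict Implicit.
Context {R : realType}.
Local Notation C := (R[i]).
Local Notation eta := (@minkowski R).
Local Notation e0 := (delta_mx 0 0 : 'rV[R]_(1 + 3)).
Local Notation E0 := (delta_mx 0 0 : 'cV[C]_(1 + 3)).
Implicit Types (u v w r : vec3 R).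

Lemma sin_mean_value (y : R) : 0 < y -> exists2 z, 0 < z < y & sin y = cos z * y.
Proof.
move=> y0; have [z zy] := MVT y0 (fun t _ => is_derive_sin t)
  (continuous_subspaceT (@continuous_sin R)).
by rewrite sin0 !subr0 => ->; exists z.
Qed.

Lemma sin_abs (y : R) : `|sin y| = `|sin `|y| |.
Proof. by case: (ger0P y) => _ //; rewrite sinN normrN. Qed.

Lemma ler_norm_sin (y : R) : `|sin y| <= `|y|.
Proof.
rewrite sin_abs; have [->|y0] := eqVneq y 0; first by rewrite normr0 sin0 normr0.
have [|z _ ->] := @sin_mean_value `|y|; first by rewrite normr_gt0.
by rewrite normrM normr_id ler_piMl // cos_max.
Qed.

(** The mean value theorem, with the cosine decreasing on [0, 1]. *)
Lemma ger_norm_sin (y : R) : `|y| <= 1 -> cos 1 * `|y| <= `|sin y|.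
Proof.
move=> y1; rewrite sin_abs; have [->|y0] := eqVneq y 0.
  by rewrite normr0 mulr0 sin0 normr0.
have [|z /andP[z0 zy] ->] := @sin_mean_value `|y|; first by rewrite normr_gt0.
have pi2 := pi_ge2 R.
have cz : cos 1 < cos z.
  rewrite ltr_cos ?in_itv /=; first exact: lt_le_trans zy y1.
    by apply/andP; split; lra.
  by apply/andP; split; lra.
rewrite normrM normr_id ler_wpM2r //.
exact: le_trans (ltW cz) (ler_norm _).
Qed.

Lemma coord_le_speed v i : `|v i 0| <= speed v.
Proof.
rewrite -sqrtr_sqr ler_wsqrtr // /dot (bigD1 i) //= -expr2 lerDl.
by apply: sumr_ge0 => j _; rewrite -expr2 sqr_ge0.
Qed.

Context (hbar c m : R) (hbar_gt0 : 0 < hbar) (c_gt0 : 0 < c) (m_gt0 : 0 < m).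
Let hbar0 : hbar != 0. Proof. by rewrite gt_eqF. Qed.
Let c0 : c != 0. Proof. by rewrite gt_eqF. Qed.
Let m0 : m != 0. Proof. by rewrite gt_eqF. Qed.
Local Notation kappa := (kappa hbar c m).
Local Notation frame_shift := (frame_shift hbar c m).
Local Notation lcse := (lcse hbar c m).

(** The wave at rest is the constant 1, since kinetic energy and momentum vanish there; boosting it
    by [v] leaves [g v] alone on one side of the duality relation. *)
Lemma de_broglie_plane_wave W g T (p : vec3 R -> vec3 R) :
  de_broglie hbar c W g T p -> forall v, subluminal c v ->
  exists xi, forall x, g v x = g v 0 * pw xi x.
Proof.
move=> [[T0 p0] _ _ dual] v vc.
have [A A0 gE] := dual v vc 0 v (subluminal0 c_gt0) vc (velocity_map_boost0 c_gt0 vc).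
have rest : matter_wave hbar c (T 0) (p 0) = pw 0.
  rewrite matter_wave_pw // T0 p0 mul0r oppr0 scaler0 trmx0.
  by rewrite (_ : 0%:M = 0) ?row_mx0 //; exact: raddf0.
move: gE; rewrite rest matter_wave_pw // => gE.
eexists => x; have := gE 0; rewrite mulmx0 !pw_at0 !mulr1 => ->.
by have := gE x; rewrite pw0 mulr1 pw_mulmx => ->.
Qed.

Lemma galilean_bound (phi : vec3 R -> spacetime R -> C) x :
  Normc.normc (phi v x - galilean_exponent hbar c m v x)
        / (speed v / c) ^+ 2 @[v --> (0 : vec3 R)^'] --> (0 : R) ->
  exists2 d, 0 < d & forall v, v != 0 -> speed v < d ->
    Normc.normc (phi v x - galilean_exponent hbar c m v x) <= (speed v / c) ^+ 2.
Proof.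
move=> /cvgrPdist_lt/(_ 1 ltr01); rewrite /dnbhs /within /= => /nbhs_ballP[d /= d0 dP].
exists d => // v v0 vd.
have B0 : 0 < (speed v / c) ^+ 2 by rewrite exprn_gt0 // divr_gt0 // speed_gt0.
(* Balls of columns are for the sup norm, which is at most [speed]. *)
have /dP/(_ v0) : ball (0 : vec3 R) d v.
  split=> [|i j]; first exact: d0.
  rewrite mxE -ball_normE /= sub0r normrN ord1.
  by rewrite (le_lt_trans (coord_le_speed _ _)).
rewrite sub0r normrN ger0_norm; last by rewrite divr_ge0 ?normc_ge0 // ltW.
by rewrite ltr_pdivrMr // mul1r; apply: ltW.
Qed.

Lemma pw_rescaled_shift (k : R) v x :
  pw (k *: (e0 *m boost_mx c v - e0)) x
  = cexp ('i%C * (k * ((gamma c v - 1) * x 0 0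
                        + gamma c v / c * dot v (space_of x)))%:C).
Proof.
rewrite /pw delta_boost delta_row_mx opp_row_mx add_row_mx oppr0 addr0 -raddfB /=.
rewrite scale_row_mx scale_scalar_mx -[(gamma c v / c) *: v^T]trmxZ -trmxZ.
by rewrite mul_row_event !dotZl; congr (cexp (_ * _%:C)); ring.
Qed.

Lemma galilean_kappa (g : vec3 R -> spacetime R -> C) (k : R) :
  (forall v, subluminal c v ->
     forall x, g v x = g v 0 * pw (k *: (e0 *m boost_mx c v - e0)) x) ->
  galilean_limit hbar c m g -> k = kappa.
Proof.
move=> gE [phi phiE lim].
pose r : vec3 R := delta_mx 0 0.
pose x' : spacetime R := col_mx 0 r.
(* Along v = h e_1 the phases differ by about h D, but only by O(h^2) because of
   the limit. *)
have [d1 d10 near1] := galilean_bound (lim x').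
have [d2 d20 near2] := galilean_bound (lim 0).
pose D := k / c - m / hbar.
suff D0 : D = 0.
  have -> : k = D * c + kappa by rewrite /D /kappa; field; apply/andP.
  by rewrite D0 mul0r add0r.
apply/eqP/negPn/negP => Dn0; have Dp : 0 < `|D| by rewrite normr_gt0.
have c2 : 0 < c ^+ 2 by rewrite exprn_gt0.
have e1 : 0 < expR 1 :> R := expR_gt0 1.
have cos1 := cos1_gt0 R.
have k1 : 0 < `|k| + 1 by rewrite ltr_wpDl.
suff : \forall h \near (0 : R)^'+, False.
  by move=> /filter_ex[].
near=> h.
have h0 : 0 < h by near: h; exact: nbhs_right_gt.
have hd1 : h < d1 by near: h; exact: nbhs_right_lt.
have hd2 : h < d2 by near: h; exact: nbhs_right_lt.
have hc : h < c / 2 by near: h; apply: nbhs_right_lt; rewrite divr_gt0.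
(* [hk] makes the relativistic correction [q] at most |D|/2, [hD] keeps [th - G] within [-1, 1], and
   [he] brings the upper bound on the sine below the lower one. *)
have hk : h < `|D| * c ^+ 2 / (`|k| + 1).
  by near: h; apply: nbhs_right_lt; rewrite divr_gt0 // mulr_gt0.
have hD : h < (2 * `|D|)^-1.
  by near: h; apply: nbhs_right_lt; rewrite invr_gt0 mulr_gt0.
have he : h < cos 1 * `|D| * c ^+ 2 / (4 * expR 1).
  by near: h; apply: nbhs_right_lt; rewrite divr_gt0 // !mulr_gt0.
pose v : vec3 R := h *: r.
have dotrr : dot r r = 1.
  rewrite /dot (bigD1 0) //= big1 => [|i /negPf i0]; rewrite !mxE.
    by rewrite eqxx addr0 mulr1.
  by rewrite i0 mul0r.
have sv : speed v = h.
  by rewrite speedZ /speed dotrr sqrtr1 mulr1 gtr0_norm.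
have v0 : v != 0 by rewrite -speed_gt0 sv.
have vc : subluminal c v by rewrite /subluminal sv; lra.
pose B := (h / c) ^+ 2.
have B0 : 0 <= B by rewrite sqr_ge0.
have Bh : B <= h / (2 * c).
  rewrite /B expr2 (_ : h / (2 * c) = (h / c) * (1 / 2)); last by field.
  rewrite ler_wpM2l ?divr_ge0 ?ltW // ltr_pdivrMr //; lra.
have B4 : B <= 1 / 4.
  rewrite (le_trans Bh) // ler_pdivrMr ?mulr_gt0 //; lra.
have n1 := near1 v v0; rewrite sv in n1; have {}n1 := n1 hd1.
have n2 := near2 v v0; rewrite sv in n2; have {}n2 := n2 hd2.
rewrite -/B in n1 n2.
have spx : space_of x' = r by rewrite /space_of col_mxKd.
have x'0 : x' 0 0 = 0 by rewrite ord0_lshift col_mxEu mxE.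
have gal0 : galilean_exponent hbar c m v 0 = 0.
  rewrite /galilean_exponent /time_of /space_of mxE mul0r mulr0 add0r.
  rewrite (_ : dsubmx 0 = 0); last by apply/matrixP => i j; rewrite !mxE.
  by rewrite dotC -(scale0r (0 : vec3 R)) dotZl mul0r !mulr0.
pose G := hbar^-1 * (m * h).
have galx : galilean_exponent hbar c m v x' = 'i%C * G%:C.
  rewrite /galilean_exponent /time_of spx x'0 mul0r mulr0 add0r dotZl dotrr.
  by rewrite mulr1.
pose th := k * (gamma c v / c * h).
have gx : g v x' = g v 0 * cexp ('i%C * th%:C).
  by rewrite gE // pw_rescaled_shift x'0 spx mulr0 add0r dotZl dotrr mulr1.
(* The deviation from the Galilean increment between the events 0 and [x']. The limit bounds it by 2
   B, and its exponential is that of the phase difference whatever logarithms were chosen. *)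
pose eps := phi v x' - 'i%C * G%:C - phi v 0.
have epsE : cexp eps = cexp ('i%C * (th - G)%:C).
  have el : phi v 0 + 'i%C * G%:C + eps = phi v x' by rewrite /eps; ring.
  have er : phi v 0 + 'i%C * G%:C + 'i%C * (th - G)%:C = phi v 0 + 'i%C * th%:C.
    by rewrite rmorphB; ring.
  apply: (mulfI (cexp_neq0 (phi v 0 + 'i%C * G%:C))).
  by rewrite -!cexpD el er cexpD -!phiE.
have neps : Normc.normc eps <= 2 * B.
  rewrite (le_trans (normcB_triangle _ _)) //.
  rewrite galx in n1; rewrite gal0 subr0 in n2.
  by lra.
have re : complex.Re eps <= 1.
  rewrite (le_trans (ler_norm _)) // (le_trans (normc_ge_Re _)) //.
  by lra.
have im : `|complex.Im eps| <= 2 * B by rewrite (le_trans (normc_ge_Im _)).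
have sinE : expR (complex.Re eps) * sin (complex.Im eps) = sin (th - G).
  by move: epsE; rewrite cexp_imaginary /cexp => -[].
have up : `|sin (th - G)| <= expR 1 * (2 * B).
  rewrite -sinE normrM ler_pM ?normr_ge0 //; last exact: le_trans (ler_norm_sin _) im.
  by rewrite gtr0_norm ?expR_gt0 // ler_expR.
pose q := k / c * (gamma c v - 1).
have thE : th - G = h * (D + q) by rewrite /th /G /D /q; field; apply/andP.
have q2 : `|q| <= `|D| / 2.
  have B2 : (speed v / c) ^+ 2 <= 1 / 2 by rewrite sv -/B; lra.
  have /andP[lo hi] := gamma_expansion c_gt0 vc B2; rewrite sv -/B in lo hi.
  have BB : B ^+ 2 <= 1 / 4 * B by rewrite expr2 ler_wpM2r.
  rewrite /q !normrM normfV (gtr0_norm c_gt0) (ger0_norm (x := gamma c v - 1)); last first.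
    by lra.
  have gB : gamma c v - 1 <= h / (2 * c).
    by lra.
  have kc : 0 <= `|k| / c by rewrite divr_ge0 // ltW.
  rewrite (le_trans (ler_wpM2l kc gB)) //.
  rewrite (_ : `|k| / c * (h / (2 * c)) = (`|k| * h) / (2 * c ^+ 2)); last by field.
  rewrite ler_pdivrMr ?mulr_gt0 //.
  move: hk; rewrite ltr_pdivlMr // => hk; rewrite mulrC.
  rewrite (_ : `|D| / 2 * _ = `|D| * c ^+ 2); last by field.
  apply: le_trans (ltW hk).
  by apply: ler_wpM2l; [exact: ltW|rewrite lerDl].
have low : `|D| / 2 <= `|D + q|.
  by have := ler_normB (D + q) q; rewrite addrK; lra.
have high : `|D + q| <= 2 * `|D|.
  by have := ler_normD D q; lra.
have y1 : `|th - G| <= 1.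
  rewrite thE normrM (gtr0_norm h0) (le_trans (ler_wpM2l (ltW h0) high)) //.
  by move: hD; rewrite -[_^-1]mul1r ltr_pdivlMr ?mulr_gt0 // => /ltW.
have := ger_norm_sin y1; rewrite thE normrM (gtr0_norm h0) -thE => lows.
have : cos 1 * (h * (`|D| / 2)) <= expR 1 * (2 * B).
  apply: le_trans up; apply: le_trans lows.
  by apply: (ler_wpM2l (ltW cos1)); apply: (ler_wpM2l (ltW h0)).
rewrite leNgt => /negP; apply.
rewrite (_ : expR 1 * (2 * B) = h * (2 * expR 1 * h / c ^+ 2)); last by rewrite /B; field.
rewrite (_ : cos 1 * _ = h * (cos 1 * `|D| / 2)); last by field.
rewrite ltr_pM2l // ltr_pdivrMr //.
move: he; rewrite ltr_pdivlMr ?mulr_gt0 // => he.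
by lra.
Unshelve. all: by end_near. Qed.

End Uniqueness.

(** * Halving the rapidity and the constant factor *)

Section HalfBoost.
Set Implicit Arguments.
Unset Strict Implicit.
Context {R : realType}.
Local Notation C := (R[i]).
Implicit Types (u v w r : vec3 R).
Context (c : R) (c_gt0 : 0 < c).
Let c0 : c != 0. Proof. by rewrite gt_eqF. Qed.

Lemma cexp_expr (z : C) n : cexp z ^+ n = cexp (n%:R * z).
Proof.
elim: n => [|n IHn]; first by rewrite expr0 mul0r cexp0.
by rewrite exprS IHn -cexpD -[in RHS]add1n natrD mulrDl mul1r.
Qed.

(* Half the rapidity: tanh (t / 2) = sinh t / (1 + cosh t). *)
Definition half_velocity v : vec3 R := (gamma c v / (1 + gamma c v)) *: v.

(** Duplication formulas for the rapidity: 2 g^2 - 1 is the cosh of its double. *)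
Lemma boost_mx_sqr u (g := gamma c u) : subluminal c u ->
  boost_mx c u *m boost_mx c u
  = block_mx (2 * g ^+ 2 - 1)%:M ((2 * g ^+ 2 / c) *: u^T)
      ((2 * g ^+ 2 / c) *: u) (1%:M + (2 * g ^+ 2 / c ^+ 2) *: (u *m u^T)).
Proof.
move=> uc; have gud := gamma_dot c_gt0 uc.
rewrite /boost_mx mulmx_block -!scalemxAl -!scalemxAr.
rewrite (boost_space_sqr c_gt0 uc) (boost_space_col c_gt0 uc).
have -> : u^T *m (1%:M + ((gamma c u - 1) / speed u ^+ 2) *: (u *m u^T))
    = gamma c u *: u^T.
  apply: trmx_inj; rewrite trmx_mul trmxZ trmxK -(boost_space_col c_gt0 uc).
  by rewrite (boost_space_tr c u).
rewrite dot_mx !mul_scalar_mx !mul_mx_scalar.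
rewrite !scale_scalar_mx -raddfD /= !scalerA -[_ *: u^T + _ *: u^T]scalerDl.
rewrite -[_ *: u + _ *: u]scalerDl -/g -expr2.
rewrite -/g in gud.
congr block_mx.
- congr (_%:M).
  rewrite (_ : g / c * _ = g ^+ 2 * dot u u / c ^+ 2); last by field.
  by rewrite gud mulfK ?expf_neq0 //; ring.
- by congr (_ *: _); field.
- by congr (_ *: _); field.
- rewrite addrCA -scalerDl; congr (_ + _ *: _); by field.
Qed.

Section Half.
Variables (v : vec3 R) (vc : subluminal c v).
Let g := gamma c v.
Let u := half_velocity v.
Let g1 : 1 <= g. Proof. exact: gamma_ge1. Qed.
Let g10 : 1 + g != 0. Proof. by rewrite gt_eqF //; have := g1; lra. Qed.

Lemma half_velocity_dot : dot u u = (g - 1) / (1 + g) * c ^+ 2.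
Proof.
rewrite /u /half_velocity dotZl dotZr -/g.
rewrite (_ : _ * _ = (g ^+ 2 * dot v v) / (1 + g) ^+ 2); last by field.
by rewrite gamma_dot // -/g; field.
Qed.

Lemma half_velocity_subluminal : subluminal c u.
Proof.
apply: dot_subluminal => //; rewrite half_velocity_dot gtr_pMl ?exprn_gt0 //.
by have := g1 => ?; rewrite ltr_pdivrMr; lra.
Qed.

Lemma half_velocity_gamma : gamma c u ^+ 2 = (1 + g) / 2.
Proof.
have := gamma_sqr c_gt0 half_velocity_subluminal.
rewrite expr_div_n speed_sqr half_velocity_dot mulfK ?expf_neq0 //.
rewrite (_ : 1 - _ = 2 / (1 + g)); last by field.
move=> e; apply: (mulIf (x := 2 / (1 + g))); last by rewrite e; field.
by rewrite mulf_neq0 // invr_eq0.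
Qed.

(** [gamma] times the speed is c sinh of the rapidity t, and sinh (t/2) = sinh t / (2 cosh (t/2)).
    Unlike the speed itself, this quantity is at least halved at each step. *)
Lemma half_velocity_speed : gamma c u * speed u <= g * speed v / 2.
Proof.
have gu := gamma_ge1 c_gt0 half_velocity_subluminal.
have gu2 := half_velocity_gamma; rewrite -/u in gu2; have g1' := g1.
rewrite [speed u]speedZ -/g ger0_norm; last by rewrite divr_ge0 //; lra.
have gE : 1 + g = 2 * gamma c u ^+ 2 by rewrite gu2; field.
rewrite -/g gE (_ : _ * (_ * _) = g * speed v / 2 / gamma c u); last first.
  by field; rewrite gt_eqF //; lra.
rewrite ler_pdivrMr; last lra.
have : 0 <= g * speed v / 2 by rewrite divr_ge0 // mulr_ge0 ?speed_ge0 //; lra.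
by move=> ?; rewrite ler_peMr.
Qed.

(** Trades the coefficient for one that is regular at [v = 0]. *)
Lemma boost_space_coef :
  ((g - 1) / speed v ^+ 2) *: (v *m v^T)
  = (g ^+ 2 / ((1 + g) * c ^+ 2)) *: (v *m v^T).
Proof.
have [v0|v0] := eqVneq (dot v v) 0; first by rewrite (dot_eq0 v0) mul0mx !scaler0.
congr (_ *: _); rewrite speed_sqr.
have gd := gamma_dot c_gt0 vc; rewrite -/g in gd.
apply: (mulIf v0); rewrite divfK // mulrAC gd; field.
by rewrite g10 c0.
Qed.

Lemma half_velocity_boost : boost_mx c u *m boost_mx c u = boost_mx c v.
Proof.
have uc := half_velocity_subluminal; have gu2 := half_velocity_gamma.
rewrite -/u in gu2 uc.
rewrite boost_mx_sqr // /boost_mx boost_space_coef -/g.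
have two : 2 * gamma c u ^+ 2 = 1 + g by rewrite gu2; field.
have uv : u = (g / (1 + g)) *: v by [].
rewrite two uv trmxZ -scalemxAl -scalemxAr !scalerA.
congr block_mx.
- by congr (_%:M); ring.
- by congr (_ *: _); field; rewrite g10 c0.
- by congr (_ *: _); field; rewrite g10 c0.
- by congr (_ + _ *: _); field; rewrite g10 c0.
Qed.

End Half.

Lemma half_velocity_iter v n : subluminal c v -> v != 0 ->
  let w := iter n half_velocity v in
  [/\ subluminal c w, w != 0 & speed w <= gamma c v * speed v / 2 ^+ n].
Proof.
move=> vc v0.
suff : [/\ subluminal c (iter n half_velocity v), iter n half_velocity v != 0 &
    gamma c (iter n half_velocity v) * speed (iter n half_velocity v)
    <= gamma c v * speed v / 2 ^+ n].
  case=> wc w0 le; split=> //; apply: le_trans le.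
  by rewrite ler_peMl ?speed_ge0 // gamma_ge1.
elim: n => [|n [wc w0 IHn]]; first by rewrite expr0 divr1.
have gw := gamma_gt0 c_gt0 wc; split.
- exact: half_velocity_subluminal.
- by rewrite /= scaler_eq0 negb_or w0 andbT gt_eqF // divr_gt0 ?addr_gt0.
- rewrite iterS; apply: (le_trans (half_velocity_speed wc)).
  by rewrite exprSr invfM mulrA ler_wpM2r.
Qed.

Lemma composes_amplitude (hbar m : R) (g : vec3 R -> spacetime R -> C) :
  is_boost_factor c g -> galilean_limit hbar c m g -> composes c g ->
  forall v, subluminal c v -> g v 0 = 1.
Proof.
move=> gf [phi phiE lim] comp v vc.
have sq w : subluminal c w -> g w 0 = g (half_velocity w) 0 ^+ 2.
  move=> wc; have uc := half_velocity_subluminal wc.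
  by rewrite (comp _ _ _ uc uc wc (half_velocity_boost wc)) mulmx0 expr2.
(* Halving fixes the zero velocity, where the punctured limit says nothing; there g 0 0 equals its
   own square and is nonzero. *)
have [->|v0] := eqVneq v 0.
  have z0 : subluminal c (0 : vec3 R) by exact: subluminal0.
  have [_ g0] := gf _ z0; have := sq _ z0.
  rewrite /half_velocity scaler0 expr2 -{1}[g 0 0]mulr1.
  by move=> /(mulfI (g0 0)) /esym.
pose w n := iter n half_velocity v.
have wP n := half_velocity_iter n vc v0.
have powE n : g v 0 = g (w n) 0 ^+ (2 ^ n).
  elim: n => [|n IHn]; first by rewrite expr1.
  have [wc _ _] := wP n.
  by rewrite IHn (sq _ wc) -exprM expnS.
pose z n := (2 ^ n)%:R * phi (w n) 0.
have gz n : g v 0 = cexp (z n).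
  by have [wc _ _] := wP n; rewrite (powE n) phiE // cexp_expr.
have [d d0 near0] := galilean_bound c_gt0 (lim 0).
pose Y := gamma c v * speed v.
have Y0 : 0 <= Y by rewrite mulr_ge0 ?speed_ge0 // ltW // gamma_gt0.
have gal0 u : galilean_exponent hbar c m u 0 = 0.
  rewrite /galilean_exponent /time_of /space_of mxE mul0r mulr0 add0r.
  rewrite (_ : dsubmx 0 = 0); last by apply/matrixP => i j; rewrite !mxE.
  by rewrite dotC dot0l !mulr0.
have half : (fun n : nat => (2^-1 : R) ^+ n) @ \oo --> (0 : R).
  by apply: cvg_expr; rewrite ger0_norm //; lra.
have zlim : (fun n => Normc.normc (z n)) @ \oo --> (0 : R).
  (* The speed of [w n] is at most Y 2^-n and [phi] is quadratically small, so the power 2^n still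
     leaves (Y/c)^2 2^-n. *)
  apply: (@squeeze_cvgr _ _ _ _ (fun=> 0) (fun n => (Y / c) ^+ 2 * 2^-1 ^+ n)).
  - near=> n; rewrite normc_ge0 /=.
    have [wc w0 ws] := wP n; rewrite -/(w n) -/Y in wc w0 ws.
    have Yd : Y * 2^-1 ^+ n < d.
      near: n; apply: (cvgr_lt (0 : R)) => //.
      by rewrite -(mulr0 Y); apply: cvgMr.
    rewrite -exprVn in ws.
    have := near0 _ w0 (le_lt_trans ws Yd); rewrite gal0 subr0 => nw.
    rewrite /z Normc.normcM natrX.
    have -> : Normc.normc ((2 : C) ^+ n) = 2 ^+ n.
      by rewrite -[2]/(1 + 1) -(rmorph1 (real_complex R)) -rmorphD -rmorphXn
        normc_real ger0_norm // exprn_ge0.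
    have p2 : 0 < (2 : R) ^+ n by rewrite exprn_gt0.
    apply: le_trans (ler_wpM2l (ltW p2) nw) _.
    rewrite exprVn (_ : _ * 2 ^- n = 2 ^+ n * ((Y * 2 ^- n) / c) ^+ 2); last first.
      by field; rewrite c0 gt_eqF.
    apply: (ler_wpM2l (ltW p2)); rewrite -exprVn.
    have a0 : 0 <= speed (w n) / c by rewrite divr_ge0 ?speed_ge0 // ltW.
    have ab : speed (w n) / c <= Y * 2^-1 ^+ n / c.
      by rewrite ler_wpM2r // invr_ge0 ltW.
    by rewrite ler_pXn2r // nnegrE (le_trans a0).
  - exact: cvg_cst.
  - by rewrite -(mulr0 ((Y / c) ^+ 2)); apply: cvgMr.
have part (f : C -> R) : (forall x, `|f x| <= Normc.normc x) ->
    (fun n => f (z n)) @ \oo --> (0 : R).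
  move=> fle; apply: (@squeeze_cvgr _ _ _ _ (fun n => - Normc.normc (z n))
    (fun n => Normc.normc (z n))) => //.
  - by near=> n; rewrite -ler_norml.
  - by rewrite -oppr0; apply: cvgN.
have re := part _ normc_ge_Re; have im := part _ normc_ge_Im.
have elim' : (fun n => expR (complex.Re (z n))) @ \oo --> (1 : R).
  by rewrite -[X in _ --> X](@expR0 R); apply: continuous_cvg => //; exact: continuous_expR.
have rel : (fun n => expR (complex.Re (z n)) * cos (complex.Im (z n))) @ \oo --> (1 : R).
  rewrite -[X in _ --> X](mulr1 1); apply: cvgM => //.
  by rewrite -[X in _ --> X](@cos0 R); apply: continuous_cvg => //; exact: continuous_cos.
have iml : (fun n => expR (complex.Re (z n)) * sin (complex.Im (z n))) @ \oo --> (0 : R).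
  rewrite -[X in _ --> X](mulr0 1); apply: cvgM => //.
  by rewrite -[X in _ --> X](@sin0 R); apply: continuous_cvg => //; exact: continuous_sin.
have cst_lim (a l : R) (f : nat -> R) : (forall n, f n = a) -> f @ \oo --> l -> a = l.
  move=> fa fl; have : f @ \oo --> a.
    by rewrite (_ : f = fun=> a); [exact: cvg_cst|exact/funext].
  by move=> fa'; apply: (cvg_unique _ fa' fl).
apply: complex_ext => /=.
- by apply: cst_lim rel => n; rewrite (gz n).
- by apply: cst_lim iml => n; rewrite (gz n).
Unshelve. all: by end_near. Qed.

End HalfBoost.

(** * Identification of the equation and assembly *)

Section MainParts.
Set Implicit Arguments.
Unset Strict Implicit.
Context {R : realType}.
Local Notation C := (R[i]).
Local Notation eta := (@minkowski R).
Local Notation e0 := (delta_mx 0 0 : 'rV[R]_(1 + 3)).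
Local Notation E0 := (delta_mx 0 0 : 'cV[C]_(1 + 3)).
Implicit Types (u v w r : vec3 R).
Context (hbar c m : R) (hbar_gt0 : 0 < hbar) (c_gt0 : 0 < c) (m_gt0 : 0 < m).
Let hbar0 : hbar != 0. Proof. by rewrite gt_eqF. Qed.
Let c0 : c != 0. Proof. by rewrite gt_eqF. Qed.
Let m0 : m != 0. Proof. by rewrite gt_eqF. Qed.
Local Notation kappa := (kappa hbar c m).
Local Notation frame_shift := (frame_shift hbar c m).
Local Notation lcse := (lcse hbar c m).

Lemma hessian_tr (F : spacetime R -> C) x : C2 F -> (hessian F x)^T = hessian F x.
Proof. by move=> F2; apply/matrixP => i j; rewrite !mxE; apply: partial_comm. Qed.

Lemma mxtrace_sym2 W (H : 'M[C]_(1 + 3)) : H^T = H ->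
  2 * \tr ((coef2 W)^T *m H) = \tr (sym2 W *m H).
Proof.
move=> HT; rewrite /sym2 mulmxDl mxtraceD mulr_natl mulr2n; congr (_ + _).
by rewrite -mxtrace_tr trmx_mul trmxK HT mxtrace_mulC.
Qed.

(** Hessians of C^2 functions are symmetric, so only [sym2], twice the symmetric part, acts; hence
    the factor [s0 / 2]. The potential is defined by absorbing [coef0 W]. *)
Lemma same_equation_lcse W (s0 b0 : C) : s0 != 0 ->
  sym2 W = s0 *: toC eta -> coef1 W = b0 *: E0 ->
  'i%C * b0 / s0 = kappa%:C ->
  exists V : spacetime R -> C, same_equation W (lcse V).
Proof.
move=> s00 sE bE kE.
have two0 : (2 : C) != 0 by rewrite pnatr_eq0.
have h20 : (2 * m / hbar ^+ 2)%:C != 0 :> C.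
  by rewrite (inj_eq (@complexI _)) gt_eqF // divr_gt0 ?mulr_gt0 ?exprn_gt0.
exists (fun x => coef0 W x * (2 / s0) / (2 * m / hbar ^+ 2)%:C).
exists (s0 / 2); first by rewrite mulf_neq0 ?invr_eq0.
move=> F F2 x; rewrite !wave_op_mx /= !mulrDr; congr (_ + _ + _).
- apply: (mulfI two0); rewrite mxtrace_sym2 ?hessian_tr // sE -scalemxAl mxtraceZ.
  have -> : (map_mx (fun a : R => a%:C) eta)^T = toC eta.
    by rewrite -[map_mx _ _]/(toC eta) -toC_tr minkowski_tr.
  by rewrite mulrA; congr (_ * _); field.
- have b0E : b0 = s0 / 2 * (- 'i%C * (2 * m * c / hbar)%:C).
    have -> : (2 * m * c / hbar)%:C = 2 * kappa%:C :> C.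
      by rewrite (_ : 2 * m * c / hbar = 2 * kappa) ?rmorphM ?rmorph_nat // /kappa; ring.
    rewrite -kE (_ : _ * (_ * _) = - ('i%C * 'i%C) * b0); last by field.
    by rewrite mulii opprK mul1r.
  rewrite bE {1}b0E !trmxZ -!scalemxAl [in LHS]mxE [in RHS]mxE mulrA.
  by rewrite -mulrA.
- move: (2 * m / hbar ^+ 2)%:C h20 => K K0.
  by field; rewrite K0 s00.
Qed.

Lemma lcse_uniqueness W g T (p : vec3 R -> vec3 R) :
  has_time_derivative W -> is_boost_factor c g ->
  lorentz_covariant c W g -> de_broglie hbar c W g T p ->
  galilean_limit hbar c m g ->
  [/\ exists V : spacetime R -> R[i], same_equation W (lcse V),
      forall v, subluminal c v -> forall x',
        g v x' = g v 0 * lcse_factor hbar c m v x' &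
      composes c g -> forall v, subluminal c v -> forall x',
        g v x' = lcse_factor hbar c m v x'].
Proof.
move=> Wt gf [rot boost] dB gal.
have gpw := de_broglie_plane_wave hbar_gt0 c_gt0 dB.
have [s0 [de [b0 [sE bE sb]]]] := isotropic_coefficients Wt rot.
have g0 v : subluminal c v -> g v 0 != 0 by move=> /gf[_]; apply.
have cov v xi : subluminal c v -> (forall x, g v x = g v 0 * pw xi x) ->
    reads_as W (in_frame (boost_mx c v) W) (boost_mx c v)
      (fun x => g v 0 * pw xi x).
  move=> vc gE; have <- : g v = fun x => g v 0 * pw xi x by apply/funext.
  exact: boost.
have [|s00 sE2 xiE] := boost_coefficients c_gt0 sE bE sb.
  move=> v vc; have [xi gE] := gpw v vc; exists (g v 0), xi.
  by split; [exact: g0|exact: cov].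
(* [xi] and the boost matrix are real, and the spatial entry of the boost compared here is nonzero,
   so the quotient is real. *)
have [k kE] : exists k : R, 'i%C * b0 / s0 = k%:C.
  pose v1 : vec3 R := (c / 2) *: delta_mx 0 0.
  have v1c : subluminal c v1.
    apply: dot_subluminal => //; rewrite dotZl dotZr /dot (bigD1 0) //= big1.
      by rewrite !mxE eqxx addr0 !mulr1 expr2; have := exprn_gt0 2 c_gt0; nra.
    by move=> i /negPf i0; rewrite !mxE i0 mul0r.
  have [xi gE] := gpw v1 v1c.
  have := xiE _ _ _ v1c (g0 _ v1c) (cov _ _ v1c gE).
  pose a := gamma c v1 / c * (c / 2).
  have a0 : a != 0.
    by rewrite gt_eqF // mulr_gt0 // divr_gt0 // gamma_gt0.
  move/matrixP/(_ 0 (rshift 1 0)); rewrite [RHS]mxE !toCE.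
  rewrite delta_boost delta_row_mx opp_row_mx add_row_mx oppr0 addr0 row_mxEr.
  rewrite !mxE eqxx mulr1 -/a => xa.
  have aC : a%:C != 0 :> C by rewrite (inj_eq (@complexI _)).
  exists (xi 0 (rshift 1 0) / a); apply: (mulIf aC).
  by rewrite -rmorphM divfK.
have gE v : subluminal c v ->
    forall x, g v x = g v 0 * pw (k *: (e0 *m boost_mx c v - e0)) x.
  move=> vc; have [xi gE] := gpw v vc.
  have := xiE _ _ _ vc (g0 _ vc) (cov _ _ vc gE); rewrite kE -toCZ => xik.
  suff <- : xi = k *: (e0 *m boost_mx c v - e0) by [].
  by apply/matrixP => i j; have /matrixP/(_ i j) := xik; rewrite !toCE => /complexI.
have kk := galilean_kappa hbar_gt0 c_gt0 gE gal.
have gE' v : subluminal c v -> forall x, g v x = g v 0 * lcse_factor hbar c m v x.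
  by move=> vc x; rewrite gE // lcse_factor_pw // kk.
split=> //.
- by apply: (same_equation_lcse s00 sE2 bE); rewrite kE kk.
- move=> comp v vc x.
  by rewrite gE' // (composes_amplitude c_gt0 gf gal comp) // mul1r.
Qed.

(** The phase kappa ((L x)^0 - x^0) makes sense for every [L], which extends the law of rotations
    and boosts to all proper Lorentz matrices. *)
Lemma scalar_potential :
  exists S : 'M[R]_(1 + 3) -> spacetime R -> R[i],
    [/\ forall M, is_rotation M -> S (rot_mx M) = fun=> 1,
        forall v, subluminal c v -> S (boost_mx c v) = lcse_factor hbar c m v &
        forall L, is_proper_lorentz L ->
          [/\ C2 (S L), forall x', S L x' != 0 &
              forall V V' : spacetime R -> R[i],
                reads_as (lcse V) (lcse V') L (S L) <->
                forall x', V' x' = V (L *m x')]].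
Proof.
exists (fun L => pw (frame_shift L)); split.
- by move=> M _; apply/funext => x; rewrite frame_shift_rot pw0.
- by move=> v _; rewrite lcse_factor_pw.
- move=> L [lL _]; split; [exact: C2_pw1|exact: pw_neq0|].
  by move=> V V'; apply: reads_as_lcse.
Qed.

End MainParts.

Theorem mainTheorem7 (R : realType) (hbar c m : R)
    (hbar_gt0 : 0 < hbar) (c_gt0 : 0 < c) (m_gt0 : 0 < m) :
  [/\ (* compatibility with a wave function that is not a strict scalar *)
      forall V : spacetime R -> R[i],
        let W := lcse hbar c m V in
        let g := lcse_factor hbar c m in
        [/\ has_time_derivative W /\ is_boost_factor c g,
            lorentz_covariant c W g /\ composes c g,
            de_broglie hbar c W g (kinetic_energy c m) (momentum c m),
            galilean_limit hbar c m g &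
            forall v, subluminal c v -> v != 0 ->
              exists x y, g v x != g v y],
      (* uniqueness; the equation being homogeneous, only the composition of
         boosts sees a constant factor of g *)
      forall (W : wave_eq R) (g : vec3 R -> spacetime R -> R[i])
             (T : vec3 R -> R) (p : vec3 R -> vec3 R),
        has_time_derivative W -> is_boost_factor c g ->
        lorentz_covariant c W g -> de_broglie hbar c W g T p ->
        galilean_limit hbar c m g ->
        [/\ exists V : spacetime R -> R[i], same_equation W (lcse hbar c m V),
            forall v, subluminal c v -> forall x',
              g v x' = g v 0 * lcse_factor hbar c m v x' &
            composes c g -> forall v, subluminal c v -> forall x',
              g v x' = lcse_factor hbar c m v x'],
      (* the equation in terms of t and r *)
      forall (V Psi : spacetime R -> R[i]), C2 Psi -> forall t r,
        wave_op (lcse hbar c m V) Psi (event c t r) = 0 <->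
        lcse_time_part hbar c m (in_tr c Psi) t r
        = hamiltonian hbar m (in_tr c V) (in_tr c Psi) t r,
      (* V is a scalar under proper Lorentz transformations *)
      exists S : 'M[R]_(1 + 3) -> spacetime R -> R[i],
        [/\ forall M, is_rotation M -> S (rot_mx M) = fun=> 1,
            forall v, subluminal c v ->
              S (boost_mx c v) = lcse_factor hbar c m v &
            forall L, is_proper_lorentz L ->
              [/\ C2 (S L), forall x', S L x' != 0 &
                  forall V V' : spacetime R -> R[i],
                    reads_as (lcse hbar c m V) (lcse hbar c m V') L (S L) <->
                    forall x', V' x' = V (L *m x')]] &
      (* V tends to the potential energy U of the Schroedinger equation *)
      forall (V : R -> spacetime R -> R[i]) (U : R -> vec3 R -> R),
        (forall t r, ccvg +oo (fun k => in_tr k (V k) t r) (U t r)%:C) <->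
        (forall Phi : spacetime R -> R[i], C2 Phi ->
           let psi := in_tr 1 Phi in
           forall t r,
             ccvg +oo (fun k => lcse_time_part hbar k m psi t r)
                      ('i%C * hbar%:C * d_t psi t r) /\
             ccvg +oo (fun k => hamiltonian hbar m (in_tr k (V k)) psi t r)
                      (hamiltonian hbar m (fun s q => (U s q)%:C) psi t r))].
Proof.
split.
- move=> V W g; split.
  + by split; [exact: has_time_derivative_lcse|exact: is_boost_factor_lcse].
  + by split; [exact: lorentz_covariant_lcse|exact: composes_lcse].
  + exact: de_broglie_lcse.
  + exact: galilean_limit_lcse.
  + exact: lcse_factor_nonconstant.
- by move=> W g T p; apply: lcse_uniqueness.
- by move=> V Psi; apply: lcse_time_space.
- exact: scalar_potential.
- by move=> V U; apply: potential_limit.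
Qed.
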